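(* Let $N\ge 1$ be an integer, let $\mathbb{Z}\alpha$ be the rank-one lattice with $(\alpha|\alpha)=2N$, and let $V_B=V_{\mathbb{Z}_{\ge 0}\alpha}$ be the Borel-type subVOA of $V_{\mathbb{Z}\alpha}$. Then $O(V_B)$ is the linear span of the following elements and subspaces: (i) $\alpha(-n-2)u+\alpha(-n-1)u$, for $n\ge 0$ and $u\in V_B$; (ii) $\alpha(-1)v+Nv$, for $v\in\bigoplus_{m\ge 1}M_{\hat{\mathfrak{h}}}(1,m\alpha)$; (iii) $M_{\hat{\mathfrak{h}}}(1,k\alpha)$, for $k\ge 2$. In particular, $A(V_B)\cong\mathbb{C}[x]\oplus\mathbb{C}y$ as associative algebras, with $y^2=0$, $yx=-Ny$ and $xy=Ny$.
   Context: Put $\mathfrak{h}=\mathbb{C}\alpha$ with the $\mathbb{C}$-bilinear form determined by $(\alpha|\alpha)=2N$, and $\hat{\mathfrak{h}}=\mathfrak{h}\otimes\mathbb{C}[t,t^{-1}]\oplus\mathbb{C}K$ with $K$ central, $h(m)=h\otimes t^m$, $[h_1(m),h_2(n)]=m\delta_{m+n,0}(h_1|h_2)K$. For $\lambda\in\mathfrak{h}$, $M_{\hat{\mathfrak{h}}}(1,\lambda)=U(\hat{\mathfrak{h}})\otimes_{U(\hat{\mathfrak{h}}_{\ge 0})}\mathbb{C}e^\lambda$, where $\hat{\mathfrak{h}}_{\ge 0}=\mathfrak{h}\otimes\mathbb{C}[t]\oplus\mathbb{C}K$ acts by $K=1$, $h(0)e^\lambda=(h|\lambda)e^\lambda$,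 $h(n)e^\lambda=0$ for $n>0$. The lattice VOA is $V_{\mathbb{Z}\alpha}=\bigoplus_{m\in\mathbb{Z}}M_{\hat{\mathfrak{h}}}(1,m\alpha)$ (with trivial cocycle $\epsilon(m\alpha,n\alpha)=1$), vacuum $\mathbf{1}=e^0$, $Y(h(-1)\mathbf{1},z)=\sum_n h(n)z^{-n-1}$, $Y(e^{m\alpha},z)=\exp\big(\sum_{n>0}\frac{m\alpha(-n)}{n}z^n\big)\exp\big(-\sum_{n>0}\frac{m\alpha(n)}{n}z^{-n}\big)e_{m\alpha}z^{m\alpha}$, where $e_{m\alpha}(w\otimes e^{p\alpha})=w\otimes e^{(m+p)\alpha}$ and $z^{m\alpha}$ acts on $M_{\hat{\mathfrak{h}}}(1,p\alpha)$ as $z^{2Nmp}$; $Y$ of a general $h_1(-n_1-1)\cdots h_k(-n_k-1)e^{m\alpha}$ is the normally ordered product of the $\frac{1}{n_i!}\partial_z^{n_i}h_i(z)$ and $Y(e^{m\alpha},z)$. The weight of $\alpha(-n_1)\cdots\alpha(-n_k)e^{m\alpha}$ is $n_1+\cdots+n_k+Nm^2$. The Virasoro element is $\omega=\frac{1}{4N}\alpha(-1)^2\mathbf{1}$. $V_B=V_{\mathbb{Z}_{\ge 0}\alpha}=\bigoplus_{m\ge 0}M_{\hat{\mathfrak{h}}}(1,m\alpha)$, a subVOA of $V_{\mathbb{Z}\alpha}$ with the same vacuum and Virasoro element. Zhu's algebra: for a VOA $V$ and homogeneous $a,b\in V$, with $Y(a,z)=\sum_n a_nz^{-n-1}$, let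 $a\circ b=\mathrm{Res}_z Y(a,z)b\frac{(1+z)^{\mathrm{wt}\,a}}{z^2}=\sum_{j\ge 0}\binom{\mathrm{wt}\,a}{j}a_{j-2}b$ and $a\ast b=\mathrm{Res}_zY(a,z)b\frac{(1+z)^{\mathrm{wt}\,a}}{z}=\sum_{j\ge0}\binom{\mathrm{wt}\,a}{j}a_{j-1}b$. $O(V)$ is the span of all $a\circ b$, and $A(V)=V/O(V)$ is an associative algebra under $\ast$ with unit $[\mathbf{1}]$. *)

(* Defs.v *)
From HB Require Import structures.
From mathcomp Require Import all_boot all_order all_algebra finmap multiset.
From mathcomp Require Import monalg ring zify.
From mathcomp Require Import boolp classical_sets cardinality fsbigop reals.
From mathcomp Require Import complex.

Set Implicit Arguments.
Unset Strict Implicit.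
Unset Printing Implicit Defensive.

Import Order.TTheory GRing.Theory Num.Theory.
Local Open Scope quotient_scope.
Local Open Scope mset_scope.
Local Open Scope classical_set_scope.
Local Open Scope ring_scope.

Section LinearSpanAndQuotient.
Variables (F : fieldType) (U : lmodType F).
Implicit Types (S : set U) (c : F) (u v : U).

Definition lspan S : set U :=
  [set v | exists n (c : 'I_n -> F) (x : 'I_n -> U),
    (forall i, S (x i)) /\ v = \sum_(i < n) c i *: x i].

Definition lspan_pred S : {pred U} := fun v => `[< lspan S v >].

Lemma lspanP S v : reflect (lspan S v) (v \in lspan_pred S).
Proof. exact: asboolP. Qed.

Lemma lspan_submod S : submod_closed (lspan_pred S).
Proof.
split=> [|a u v /asboolP[m [c [x [Sx ->]]]] /asboolP[n [d [y [Sy ->]]]]].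
  apply/asboolP; exists 0%N, (fun=> 0), (fun=> 0).
  by rewrite big_ord0; split=> // -[].
apply/asboolP; exists (m + n)%N.
exists (fun i => match split i with inl j => a * c j | inr j => d j end).
exists (fun i => match split i with inl j => x j | inr j => y j end).
split=> [i|]; first by case: split.
rewrite big_split_ord scaler_sumr /=; congr (_ + _); apply: eq_bigr => i _.
  by rewrite (unsplitK (inl i)) scalerA.
by rewrite (unsplitK (inr i)).
Qed.

HB.instance Definition _ S :=
  GRing.isSubmodClosed.Build F U (lspan_pred S) (lspan_submod S).

(* U / lspan S *)
Definition lquot S : Type := Quotient.quot (lspan_pred S).
HB.instance Definition _ S := GRing.Zmodule.on (lquot S).
Definition lclass S : U -> lquot S := \pi_(Quotient.quot (lspan_pred S)).

Lemma lclassP S u v : reflect (lspan S (u - v)) (lclass S u == lclass S v).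
Proof. by rewrite /lclass -Quotient.idealrBE; apply: asboolP. Qed.

Lemma lclass_repr S (X : lquot S) : lclass S (repr X) = X.
Proof. exact: reprK. Qed.

Lemma lclass_is_zmod_morphism S : zmod_morphism (lclass S).
Proof. by move=> u v; rewrite /lclass !piE. Qed.

HB.instance Definition _ S :=
  GRing.isZmodMorphism.Build U (lquot S) (lclass S) (lclass_is_zmod_morphism S).

Definition lquot_scale S c (X : lquot S) : lquot S := lclass S (c *: repr X).

Lemma lclassZ S c u : lclass S (c *: u) = lquot_scale c (lclass S u).
Proof.
apply/eqP/lclassP; rewrite -scalerBr; apply/lspanP/rpredZ/lspanP.
by apply/lclassP; rewrite lclass_repr.
Qed.

Fact lquot_scaleA S a b (X : lquot S) :
  lquot_scale a (lquot_scale b X) = lquot_scale (a * b) X.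
Proof. by rewrite -[X]lclass_repr -!lclassZ scalerA. Qed.

Fact lquot_scale1 S : left_id 1 (@lquot_scale S).
Proof. by move=> X; rewrite -[X]lclass_repr -lclassZ scale1r. Qed.

Fact lquot_scaleDr S : right_distributive (@lquot_scale S) +%R.
Proof.
move=> a X Y; rewrite -[X]lclass_repr -[Y]lclass_repr.
by rewrite -raddfD -!lclassZ scalerDr raddfD.
Qed.

Fact lquot_scaleDl S (X : lquot S) :
  {morph (@lquot_scale S)^~ X : a b / a + b}.
Proof. by move=> a b; rewrite -[X]lclass_repr -!lclassZ scalerDl raddfD. Qed.

HB.instance Definition _ S := GRing.Zmodule_isLmodule.Build F (lquot S)
  (@lquot_scaleA S) (@lquot_scale1 S) (@lquot_scaleDr S) (@lquot_scaleDl S).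

End LinearSpanAndQuotient.

(* Zhu's construction, for a state space U with weight projections wp,
   modes Y a n = a_n and vacuum vac. *)
Section Zhu.
Variables (F : fieldType) (U : lmodType F).
Variables (Y : U -> int -> U -> U) (wp : nat -> U -> U) (vac : U).

Definition homog (d : nat) (a : U) : Prop := wp d a = a.

(* Res_z Y(a,z) b (1+z)^d / z^p, where d is the weight of a *)
Definition zhu_res (p d : nat) (a b : U) : U :=
  \sum_(j < d.+1) 'C(d, j)%:R *: Y a (j%:Z - p%:Z) b.

Definition zhu_circ := zhu_res 2.

Definition zhu_circs : set U :=
  [set x | exists d e a b, [/\ homog d a, homog e b & x = zhu_circ d a b]].

Definition zhuO : set U := lspan zhu_circs.

(* a * b for arbitrary a, by linearity in the homogeneous components of a *)
Definition zhu_star (a b : U) : U :=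
  \sum_(d \in [set: nat]) zhu_res 1 d (wp d a) b.

Definition zhuA : Type := lquot zhu_circs.
HB.instance Definition _ := GRing.Lmodule.on zhuA.

Definition zhu_class : U -> zhuA := lclass zhu_circs.

Definition zhu_mul (X W : zhuA) : zhuA := zhu_class (zhu_star (repr X) (repr W)).
Definition zhu_one : zhuA := zhu_class vac.
End Zhu.

Section Lattice.
Variables (F : fieldType) (N : nat).

(* (s, m) stands for the basis vector prod_(n <- s) alpha(-n-1) e^(m alpha) *)
Definition idx : Type := ({mset nat} * int)%type.
HB.instance Definition _ := Choice.on idx.

Local Notation VL := {malg F[idx]}.
Implicit Types (P Q : pred int) (k : idx) (a u v : VL).

Definition bas k : VL := << k >>.

Definition linext (W : lmodType F) (f : idx -> W) v : W :=
  \sum_(k <- msupp v) v@_k *: f k.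

Definition bpart (B : pred idx) v : VL :=
  linext (fun k => if B k then bas k else 0) v.

(* alpha(n), where (alpha|alpha) = 2N: creation, charge and annihilation *)
Definition heis (n : int) : VL -> VL :=
  linext (fun k : idx => let: (s, p) := k in
    match n with
    | Negz i => bas ((i +` s)%mset, p)
    | Posz 0 => ((2 * N)%:R * p%:~R) *: bas (s, p)
    | Posz i.+1 => (2 * N * i.+1 * s i)%:R *: bas ((s `\ i)%mset, p)
    end).

(* A field A(z) = sum_n A_n z^(-n-1) is given by its modes A_n. *)
Definition vfield : Type := int -> VL -> VL.

Definition fderiv (A : vfield) : vfield :=
  fun n v => (- n)%:~R *: A (n - 1) v.

Definition fdivderiv (i : nat) (A : vfield) : vfield :=
  fun n v => (i`!%:R)^-1 *: iter i fderiv A n v.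

(* :A(z)B(z): = A(z)_- B(z) + B(z) A(z)_+ with A(z)_- = sum_(n<0) A_n z^(-n-1) *)
Definition nop (A B : vfield) : vfield := fun n v =>
  \sum_(i \in [set i : int | i < 0]) A i (B (n - i - 1) v)
  + \sum_(i \in [set i : int | 0 <= i]) B (n - i - 1) (A i v).

(* opow X j i is the coefficient of z^i in (sum_(n>0) X_n z^n)^j, and
   oexp X i the one in exp (sum_(n>0) X_n z^n). *)
Fixpoint opow (X : nat -> VL -> VL) (j i : nat) (v : VL) : VL :=
  if j is j'.+1 then \sum_(1 <= n < i.+1) X n (opow X j' (i - n) v)
  else if i == 0%N then v else 0.

Definition oexp (X : nat -> VL -> VL) (i : nat) (v : VL) : VL :=
  \sum_(j < i.+1) (j`!%:R)^-1 *: opow X j i v.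

Definition expneg (m : int) : nat -> VL -> VL :=
  oexp (fun n v => (m%:~R / n%:R) *: heis (- n%:Z) v).

Definition exppos (m : int) : nat -> VL -> VL :=
  oexp (fun n v => - (m%:~R / n%:R) *: heis n%:Z v).

Definition eshift (m : int) : VL -> VL :=
  linext (fun k => bas (k.1, m + k.2)).

(* coefficient of z^l in z^(m alpha) *)
Definition zpow (m l : int) : VL -> VL :=
  bpart (fun k => (2 * N)%:Z * m * k.2 == l).

(* Y(e^(m alpha), z); the index ((i, j), l) selects the coefficients of
   z^i, z^(-j), z^l in the two exponentials and in z^(m alpha). *)
Definition Yexp (m : int) : vfield := fun n v =>
  \sum_(t \in [set t : nat * nat * int | t.1.1%:Z - t.1.2%:Z + t.2 = - n - 1])
    expneg m t.1.1 (exppos m t.1.2 (eshift m (zpow m t.2 v))).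

Definition Ybas k : vfield :=
  foldr (fun i B => nop (fdivderiv i heis) B) (Yexp k.2) (k.1 : seq nat).

Definition YL a n v : VL := linext (fun k => Ybas k n v) a.

Definition weight k : nat :=
  (\sum_(i <- (k.1 : seq nat)) i.+1 + N * `|k.2| ^ 2)%N.

Definition wpartL (d : nat) : VL -> VL := bpart (fun k => weight k == d).

(* the direct sum of the M(1, m alpha) over the m satisfying P *)
Definition charges (P : pred int) : {pred VL} :=
  fun v => all (fun k => P k.2) (msupp v).

Lemma charges_submod P : submod_closed (charges P).
Proof.
split=> [|c u v /allP Pu /allP Pv]; first by rewrite /charges unfold_in msupp0.
apply/allP=> k /(fsubsetP (msuppD_le _ _)) /fsetUP[]; last exact: Pv.
by move/(fsubsetP (msuppZ_le _ _)); apply: Pu.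
Qed.
HB.instance Definition _ P :=
  GRing.isSubmodClosed.Build F VL (charges P) (charges_submod P).

Lemma charges_bas P k : P k.2 -> bas k \in charges P.
Proof.
by move=> Pk; apply/allP=> i; rewrite msuppU oner_eq0 inE => /eqP->.
Qed.

Lemma charges_linext P Q f v : (forall k, P k.2 -> f k \in charges Q) ->
  v \in charges P -> linext f v \in charges Q.
Proof.
move=> Qf /allP Pv; rewrite /linext big_seq; apply: rpred_sum => k /Pv Pk.
by apply/rpredZ/Qf.
Qed.

Definition keeps P (A : VL -> VL) := {homo A : v / v \in charges P}.
Definition fkeeps P (A : vfield) := forall n, keeps P (A n).

Lemma keeps_bpart P (B : pred idx) : keeps P (bpart B).
Proof.
by move=> v; apply: charges_linext => k Pk; case: ifP; rewrite ?rpred0 ?charges_bas.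
Qed.

Lemma keeps_heis P : fkeeps P heis.
Proof.
move=> n v; apply: charges_linext => -[s p] /= Pp.
by case: n => [[|i]|i]; rewrite ?rpredZ// charges_bas.
Qed.

Lemma keeps_divderiv P i A : fkeeps P A -> fkeeps P (fdivderiv i A).
Proof.
move=> PA n v Pv; apply: rpredZ; elim: i n => [|i IH] n; first exact: PA.
by rewrite iterS; apply: rpredZ.
Qed.

Lemma keeps_nop P A B : fkeeps P A -> fkeeps P B -> fkeeps P (nop A B).
Proof.
by move=> PA PB n v Pv; apply: rpredD; apply: rpred_sum => i _;
   do 2?[exact: Pv | apply: PA | apply: PB].
Qed.

Lemma keeps_oexp P X : (forall n, keeps P (X n)) -> forall i, keeps P (oexp X i).
Proof.
move=> PX i v Pv; apply: rpred_sum => j _; apply: rpredZ.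
move: (j : nat) => l; elim: l i {j} => [|l IH] r /=; first by case: eqP; rewrite ?rpred0.
by apply: rpred_sum => n _; apply/PX/IH.
Qed.

Lemma keeps_Yexp P m : {homo +%R m : p / P p} -> fkeeps P (Yexp m).
Proof.
move=> Pm n v Pv; apply: rpred_sum => t _.
apply: keeps_oexp => [i u Pu|]; first by apply/rpredZ/keeps_heis.
apply: keeps_oexp => [i u Pu|]; first by apply/rpredZ/keeps_heis.
apply: (charges_linext (P := P)); last exact: keeps_bpart.
by move=> k Pk; apply/charges_bas/Pm.
Qed.

Lemma keeps_Ybas P k : {homo +%R k.2 : p / P p} -> fkeeps P (Ybas k).
Proof.
move=> Pk; rewrite /Ybas; elim: (k.1 : seq nat) => [|i s IH]; first exact: keeps_Yexp.
by apply: keeps_nop => //; apply/keeps_divderiv/keeps_heis.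
Qed.

Definition nonneg : pred int := fun m => 0 <= m.

Lemma VB_YL a n v : a \in charges nonneg -> v \in charges nonneg ->
  YL a n v \in charges nonneg.
Proof.
move=> Va Vv; apply: charges_linext Va => k k0; apply: keeps_Ybas => // p.
exact: addr_ge0.
Qed.

Record VB : Type := InVB { vbval : VL; vbvalP : vbval \in charges nonneg }.
HB.instance Definition _ := [isSub for vbval].
HB.instance Definition _ := [Choice of VB by <:].
HB.instance Definition _ := [SubChoice_isSubLmodule of VB by <:].

Definition vacB : VB :=
  InVB (@charges_bas nonneg (mset0, 0) (lexx _)).

Definition YB (a : VB) (n : int) (v : VB) : VB :=
  InVB (VB_YL n (vbvalP a) (vbvalP v)).

Definition wpartB (d : nat) (v : VB) : VB :=
  InVB (keeps_bpart (fun k => weight k == d) (vbvalP v)).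

Definition heisB (n : int) (v : VB) : VB := InVB (keeps_heis n (vbvalP v)).

Definition chargesB (P : pred int) : set VB := [set v | vbval v \in charges P].
End Lattice.

(* M(1, m alpha) is the module induced from C e^(m alpha): it satisfies the
   Heisenberg relations and the universal property of the induced module. *)
Section Induced.
Variables (F : fieldType) (N : nat).
Local Notation VL := {malg F[idx]}.
Implicit Types (k : idx) (u v : VL).

Definition heis_rel (W : lmodType F) (A : int -> W -> W) : Prop :=
  forall i j w, A i (A j w) - A j (A i w) =
    (if i + j == 0 then (2 * N)%:R * i%:~R else 0) *: w.

Definition hw_vector (W : lmodType F) (A : int -> W -> W) (m : int) (w : W) :=
  A 0 w = ((2 * N)%:R * m%:~R) *: w /\ forall i : nat, A i.+1 w = 0.

Lemma linextE (W : lmodType F) (f : idx -> W) (d : {fset idx}) v :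
  (msupp v `<=` d)%fset -> linext f v = \sum_(k <- d) v@_k *: f k.
Proof.
move=> sub; rewrite /linext (big_fset_incl _ sub)// => k _ /mcoeff_outdom ->.
by rewrite scale0r.
Qed.

Lemma linext_is_linear (W : lmodType F) (f : idx -> W) : linear (linext f).
Proof.
move=> c u v; set d := (msupp u `|` msupp v `|` msupp (c *: u + v))%fset.
rewrite !(@linextE _ _ d) ?scaler_sumr -?big_split/=.
  by apply: eq_bigr => k _; rewrite mcoeffD mcoeffZ scalerDl scalerA.
all: by apply/fsubsetP=> k kd; rewrite !inE kd ?orbT.
Qed.
HB.instance Definition _ (W : lmodType F) (f : idx -> W) :=
  GRing.isLinear.Build F VL W *:%R (linext f) (linext_is_linear f).
HB.instance Definition _ n := GRing.Linear.copy (@heis F N n) (linext _).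

Lemma linext_bas (W : lmodType F) (f : idx -> W) k : linext f (bas F k) = f k.
Proof. by rewrite /linext msuppU oner_eq0 big_seq_fset1 mcoeffUU scale1r. Qed.

Lemma malg_basE v : v = \sum_(k <- msupp v) v@_k *: bas F k.
Proof.
rewrite {1}(monalgE v); apply: eq_bigr => k _; apply/malgP=> i.
by rewrite mcoeffZ !mcoeffU mulr_natr.
Qed.

Lemma heis_basE n k : heis N n (bas F k) =
  match n with
  | Negz i => bas F ((i +` k.1)%mset, k.2)
  | Posz 0 => ((2 * N)%:R * k.2%:~R) *: bas F k
  | Posz i.+1 => (2 * N * i.+1 * k.1 i)%:R *: bas F ((k.1 `\ i)%mset, k.2)
  end.
Proof. by rewrite [LHS]linext_bas; case: k n => s p [[|i]|i]. Qed.


Lemma heis2E i j v : heis N i (heis N j v) =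
  \sum_(k <- msupp v) v@_k *: heis N i (heis N j (bas F k)).
Proof.
rewrite {1}[v]malg_basE (raddf_sum (heis N j)) (raddf_sum (heis N i)) /=.
apply: eq_bigr => k _; rewrite (linearZ_LR (heis N j)) /=. exact: (linearZ_LR (heis N i)).
Qed.

Lemma heis_mixed (i j : nat) (s : {mset nat}) (p : int) :
  (2 * N * i.+1 * (j +` s)%mset i)%:R *: bas F (((j +` s) `\ i)%mset, p) -
  (2 * N * i.+1 * s i)%:R *: bas F ((j +` (s `\ i))%mset, p) =
  (if i == j then (2 * N)%:R * i.+1%:~R else 0) *: bas F (s, p).
Proof.
rewrite mset1DE; case: eqVneq => [->|ij].
  rewrite msetD1K; have [s0|sj] := posnP (s j).
    by rewrite s0 muln0 scale0r subr0 addn0 muln1 natrM.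
  rewrite msetB1K ?in_mset// -scalerBl -natrB ?leq_mul2l ?leq_addl ?orbT//.
  by rewrite -mulnBr addnK muln1 natrM.
rewrite add0n; have -> : ((j +` s) `\ i = j +` (s `\ i))%mset.
  apply/msetP=> x; rewrite !(msetB1E, mset1DE).
  by case: (eqVneq x j) => [->|_]; rewrite // eq_sym (negPf ij) !subn0.
by rewrite subrr scale0r.
Qed.

Lemma heis_relP : heis_rel (@heis F N).
Proof.
move=> i j v; rewrite !heis2E -sumrB {4}[v]malg_basE scaler_sumr.
apply: eq_bigr => -[s p] _; rewrite -scalerBr [RHS]scalerA [_ * v@_ _]mulrC -[RHS]scalerA.
congr (_ *: _).
case: i j => [[|i]|i] [[|j]|j]; rewrite ?heis_basE ?(linearZ_LR (heis N _)) /= ?heis_basE/=.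
- by rewrite subrr mulr0 scale0r.
- by rewrite !scalerA mulrC subrr scale0r.
- by rewrite subrr scale0r.
- by rewrite !scalerA mulrC subrr scale0r.
- rewrite scale0r !scalerA -!natrM; apply/eqP; rewrite subr_eq0; apply/eqP.
  have -> : (s `\ j `\ i)%mset = (s `\ i `\ j)%mset.
    by apply/msetP=> x; rewrite !msetB1E subnAC.
  congr (_%:R *: _); rewrite !msetB1E [i == j]eq_sym.
  by case: eqVneq => [->//|_] /=; rewrite !subn0; lia.
- have -> : (i.+1%:Z + Negz j == 0) = (i == j) by lia.
  exact: heis_mixed.
- by rewrite subrr scale0r.
- have -> : (Negz i + j.+1%:Z == 0) = (j == i) by lia.
  rewrite -opprB heis_mixed -scaleNr; case: eqVneq => [->|_]; rewrite ?oppr0//.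
  by rewrite NegzE mulrNz mulrN.
- rewrite scale0r; apply/eqP; rewrite subr_eq0; apply/eqP; congr (bas F (_, _)).
  by apply/msetP=> x; rewrite !mset1DE addnCA.
Qed.

Lemma heis_hw m : hw_vector (@heis F N) m (bas F (mset0, m)).
Proof.
split=> [|i]; first by rewrite heis_basE.
by rewrite heis_basE /= mset0E muln0 scale0r.
Qed.

Lemma perm_mset1D (i : nat) (s : {mset nat}) : perm_eq (i +` s)%mset (i :: s).
Proof.
apply/eq_seq_msetP/msetP=> x; rewrite !mset_seqE /= !count_mem_mset mset1DE.
by rewrite eq_sym.
Qed.

Section Universal.
Variables (W : lmodType F) (A : int -> {linear W -> W}) (m : int) (w : W).
Hypothesis A_rel : heis_rel A.
Hypothesis w_hw : hw_vector A m w.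

Let G (s : seq nat) : W := foldr (fun i => A (Negz i)) w s.

Let AC i j x : i + j != 0 -> A i (A j x) = A j (A i x).
Proof.
by move=> /negPf ij; apply/eqP; rewrite -subr_eq0 A_rel ij scale0r.
Qed.

Let G_rem i s : i \in s -> G s = A (Negz i) (G (rem i s)).
Proof.
elim: s => //= x s IH; rewrite inE; case: eqVneq => [<-//|ix] /= /IH {1}->.
by rewrite AC//; lia.
Qed.

Let G_perm s t : perm_eq s t -> G s = G t.
Proof.
elim: s t => [|i s IH] t st; first by move: st; rewrite perm_sym => /perm_nilP ->.
have it : i \in t by rewrite -(perm_mem st) mem_head.
rewrite (G_rem it) /= (IH (rem i t))//.
by rewrite -(perm_cons i) (perm_trans st)// perm_to_rem.
Qed.

Let G_ann (i : nat) s :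
  A i.+1 (G s) = (2 * N * i.+1 * count_mem i s)%:R *: G (rem i s).
Proof.
elim: s => [|x s IH] /=; first by rewrite w_hw.2 muln0 scale0r.
have /eqP := A_rel i.+1 (Negz x) (G s); rewrite subr_eq => /eqP ->.
have -> : (i.+1%:Z + Negz x == 0) = (x == i) by lia.
rewrite IH linearZ_LR /=; case: eqVneq => [->|xi] /=; last first.
  by rewrite scale0r !add0r add0n.
have [/G_rem <-|/count_memPn ->] := boolP (i \in s); last first.
  by rewrite muln0 scale0r addr0 addn0 muln1 (natrM _ (2 * N)).
by rewrite -scalerDl mulnDr muln1 natrD (natrM _ (2 * N) i.+1).
Qed.

Let G_charge s : A 0 (G s) = ((2 * N)%:R * m%:~R) *: G s.
Proof.
by elim: s => [|i s IH] /=; rewrite ?w_hw.1// AC// IH linearZ_LR.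
Qed.

Definition induced_map : VL -> W := linext (fun k => G (k.1 : seq nat)).
HB.instance Definition _ := GRing.Linear.copy induced_map (linext _).

Lemma induced_map_bas s p : induced_map (bas F (s, p)) = G s.
Proof. exact: linext_bas. Qed.

Lemma induced_mapP : induced_map (bas F (mset0, m)) = w /\
  {in charges (pred1 m), forall v n, induced_map (heis N n v) = A n (induced_map v)}.
Proof.
split=> [|v /allP vm n]; first by rewrite induced_map_bas enum_mset0.
rewrite [v]malg_basE (raddf_sum (heis N n)) !(raddf_sum induced_map) /=.
rewrite raddf_sum big_seq [RHS]big_seq; apply: eq_bigr => -[s p] /vm /= /eqP ->.
rewrite (linearZ_LR (heis N n)) !(linearZ_LR induced_map) /= linearZ_LR /=.
congr (_ *: _); rewrite heis_basE induced_map_bas; case: n => [[|i]|i] /=.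
- by rewrite (linearZ_LR induced_map) /= induced_map_bas G_charge.
- rewrite (linearZ_LR induced_map) /= induced_map_bas G_ann count_mem_mset.
  have [->|si] := posnP (s i); first by rewrite muln0 !scale0r.
  congr (_ *: _); apply: G_perm; rewrite -(perm_cons i).
  apply: (@perm_trans _ s); last by rewrite perm_to_rem// in_mset.
  by rewrite perm_sym -{1}(@msetB1K _ i s) ?in_mset// perm_mset1D.
- by rewrite induced_map_bas (G_perm (perm_mset1D i s)).
Qed.

Lemma induced_map_uniq (g : {linear VL -> W}) : g (bas F (mset0, m)) = w ->
  {in charges (pred1 m), forall v n, g (heis N n v) = A n (g v)} ->
  {in charges (pred1 m), g =1 induced_map}.
Proof.
move=> gw gA v /allP vm; rewrite [v]malg_basE !raddf_sum /=.
rewrite big_seq [RHS]big_seq; apply: eq_bigr => -[s p] /vm /= /eqP ->.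
rewrite !linearZ_LR /=; congr (_ *: _); rewrite induced_map_bas.
rewrite -[s in LHS]seq_mset_id; move: (s : seq nat) => t; elim: t => [|i t IH].
  rewrite [RHS]/= -gw; congr (g (bas F (_, m))).
  by apply/msetP=> x; rewrite mset_seqE mset0E.
have -> : seq_mset (i :: t) = (i +` seq_mset t)%mset.
  by apply/msetP=> x; rewrite mset1DE !mset_seqE /= eq_sym.
rewrite -(heis_basE (Negz i) (_, _)) gA ?IH//.
by apply: charges_bas => /=; rewrite eqxx.
Qed.
End Universal.
End Induced.

(* C[x] (+) C y with y^2 = 0, x y = N y, y x = - N y: XY p c stands for
   p(x) + c y, and p(x) y = p(N) y, y q(x) = q(-N) y. *)
Record xyalg (F : fieldType) (N : nat) : Type := MkXY { xyp : {poly F}; xyc : F }.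


Section TargetAlgebra.
Variables (F : fieldType) (N : nat).
Local Notation xyalg := (xyalg F N).
Local Notation XY := (@MkXY F N).
Implicit Types (a b c : xyalg) (r s : F).

Definition xy_pair a := (xyp a, xyc a).
Definition xy_unpair (u : {poly F} * F) : xyalg := XY u.1 u.2.
Fact xy_pairK : cancel xy_pair xy_unpair. Proof. by case. Qed.
HB.instance Definition _ := Choice.copy xyalg (can_type xy_pairK).

Definition xy_add a b := XY (xyp a + xyp b) (xyc a + xyc b).
Definition xy_opp a := XY (- xyp a) (- xyc a).
Definition xy_scale r a := XY (r *: xyp a) (r * xyc a).
Definition xy_mul a b :=
  XY (xyp a * xyp b) ((xyp a).[N%:R] * xyc b + xyc a * (xyp b).[- N%:R]).

Fact xy_addA : associative xy_add.
Proof. by move=> a b c; rewrite /xy_add /= !addrA. Qed.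
Fact xy_addC : commutative xy_add.
Proof. by move=> a b; congr XY; rewrite addrC. Qed.
Fact xy_add0 : left_id (XY 0 0) xy_add.
Proof. by case=> p r; rewrite /xy_add /= !add0r. Qed.
Fact xy_addN : left_inverse (XY 0 0) xy_opp xy_add.
Proof. by case=> p r; rewrite /xy_add /= !addNr. Qed.
HB.instance Definition _ :=
  GRing.isZmodule.Build xyalg xy_addA xy_addC xy_add0 xy_addN.

Fact xy_scaleA r s a : xy_scale r (xy_scale s a) = xy_scale (r * s) a.
Proof. by rewrite /xy_scale /= scalerA mulrA. Qed.
Fact xy_scale1 : left_id 1 xy_scale.
Proof. by case=> p r; rewrite /xy_scale /= scale1r mul1r. Qed.
Fact xy_scaleDr : right_distributive xy_scale +%R.
Proof. by move=> r a b; rewrite /xy_scale /= scalerDr mulrDr. Qed.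
Fact xy_scaleDl a : {morph xy_scale^~ a : r s / r + s}.
Proof. by move=> r s; rewrite /xy_scale /= scalerDl mulrDl. Qed.
HB.instance Definition _ := GRing.Zmodule_isLmodule.Build F xyalg
  xy_scaleA xy_scale1 xy_scaleDr xy_scaleDl.

Fact xy_mulA : associative xy_mul.
Proof. by move=> a b c; congr XY; rewrite /= ?mulrA// !hornerM; ring. Qed.
Fact xy_mul1l : left_id (XY 1 0) xy_mul.
Proof. by case=> p r; congr XY; rewrite /= ?hornerC; ring. Qed.
Fact xy_mul1r : right_id (XY 1 0) xy_mul.
Proof. by case=> p r; congr XY; rewrite /= ?hornerC; ring. Qed.
Fact xy_mulDl : left_distributive xy_mul +%R.
Proof. by move=> a b c; congr XY; rewrite /= ?hornerD; ring. Qed.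
Fact xy_mulDr : right_distributive xy_mul +%R.
Proof. by move=> a b c; congr XY; rewrite /= ?hornerD; ring. Qed.
Fact xy_one_neq0 : XY 1 0 != 0 :> xyalg.
Proof. by apply/eqP=> -[/eqP]; rewrite oner_eq0. Qed.
HB.instance Definition _ := GRing.Zmodule_isNzRing.Build xyalg
  xy_mulA xy_mul1l xy_mul1r xy_mulDl xy_mulDr xy_one_neq0.

Fact xy_scaleAl r a b : r *: (a * b) = (r *: a) * b.
Proof. by congr XY; rewrite /= ?scalerAl// hornerZ; ring. Qed.
HB.instance Definition _ := GRing.Lmodule_isLalgebra.Build F xyalg xy_scaleAl.
Fact xy_scaleAr r a b : r *: (a * b) = a * (r *: b).
Proof. by congr XY; rewrite /= ?scalerAr// hornerZ; ring. Qed.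
HB.instance Definition _ := GRing.Lalgebra_isAlgebra.Build F xyalg xy_scaleAr.

Definition xyX : xyalg := XY 'X 0.
Definition xyY : xyalg := XY 0 1.

Lemma xyYY : xyY * xyY = 0.
Proof. by congr XY; rewrite /= ?hornerC; ring. Qed.
Lemma xyXY : xyX * xyY = N%:R *: xyY.
Proof. by congr XY; rewrite /= ?scaler0 ?hornerX; ring. Qed.
Lemma xyYX : xyY * xyX = - N%:R *: xyY.
Proof. by congr XY; rewrite /= ?scaler0 ?hornerX ?horner0; ring. Qed.

Lemma xyE (p : {poly F}) r : XY p r = horner_alg xyX p + r *: xyY.
Proof.
suff -> : horner_alg xyX p = XY p 0.
  by congr XY; rewrite /= ?scaler0; ring.
elim/poly_ind: p => [|p s IH]; first by rewrite rmorph0.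
rewrite rmorphD rmorphM /= horner_algX horner_algC IH.
by congr XY; rewrite /= ?alg_polyC// hornerX; ring.
Qed.
End TargetAlgebra.

Definition alg_isomorphic (F : fieldType) (A : lmodType F)
    (mulA : A -> A -> A) (oneA : A) (B : algType F) : Prop :=
  exists f : {linear A -> B}, [/\ bijective f, f oneA = 1 &
    forall a b, f (mulA a b) = f a * f b].

(* Main.v *)
Require Import Defs.
From HB Require Import structures.
From mathcomp Require Import all_boot all_order all_algebra finmap multiset.
From mathcomp Require Import monalg ring zify.
From mathcomp Require Import boolp classical_sets fsbigop reals complex.

Set Implicit Arguments.
Unset Strict Implicit.
Unset Printing Implicit Defensive.

Import Order.TTheory GRing.Theory Num.Theory.
Local Open Scope mset_scope.
Local Open Scope classical_set_scope.
Local Open Scope ring_scope.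

(** Write x for the class of alpha(-1)1 and y for the class of e^alpha.  The
    target algebra C[x] + C y already describes how A(V_B) should look, so one
    can guess the quotient map V_B -> A(V_B) on the monomial basis:
      alpha(-i_1-1) ... alpha(-i_r-1) e^(p alpha)
        |->  (-1)^(i_1 + ... + i_r) (class of e^(p alpha)) x^r,
    where the class of e^(p alpha) is 1, y, 0 for p = 0, p = 1, p >= 2.  This is
    the linear map [symb]; a creation operator alpha(-i-1) becomes right
    multiplication by (-1)^i x ([symb_create]).  Let J be the span of (i), (ii)
    and (iii).  The theorem follows from the chain J <= O(V_B) <= ker symb <= J.

    O(V_B) <= ker symb.  Apply symb to the coefficients of (1+z)^(wt a) Y(a,z) b.
    The claim, stronger than needed for O(V_B) alone, is that the resulting
    Laurent series has constant term symb(a) symb(b) and no term of positive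
    degree in z ([symb_zhu_res]).  The coefficient of z is symb(a o b), so O(V_B)
    is killed; the constant term is symb(a * b), so symb is multiplicative.  The
    claim is proved along the construction of Y(a,z).  For a = e^alpha, the
    creation exponential becomes (1+z)^(-N) on charge one because alpha(-1) acts
    as -N there, and it cancels (1+z)^(wt e^alpha) = (1+z)^N; what remains is the
    annihilation exponential, a polynomial in 1/z ([has_symbol_Yexp1]).  For
    a normally ordered product with the q-th divided derivative of alpha(z), the
    creation half becomes right multiplication by (-1)^q x times (1+z)^(-q-1),
    cancelling the extra factor (1+z)^(q+1); the annihilation half contributes
    only alpha(0) to the constant term, and x symb(v) = symb(v) x +
    symb(alpha(0) v) recombines both halves ([has_symbol_nop]).

    J <= O(V_B).  The generators (i) are, up to the factor n+1,
    alpha(-n-1)1 o u ([shift_in_O]).  Modulo them, a o 1 = (L(-1) + L(0)) a equals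
    p (alpha(-1) + N p) a for a of charge p, which gives (ii) in charge one and
    shows that O(V_B) absorbs all of M(1, p alpha), p >= 2, once it contains
    e^(p alpha) ([derivation_in_O], [charge2_in_O]).  Finally e^(p alpha) is, up
    to a nonzero factor, alpha(-q-1)e^alpha o e^((p-1) alpha) for
    q = 2N(p-1) - 2: this q is chosen so that the only pole of the product has
    e^(p alpha) as residue ([top_in_O]).

    ker symb <= J.  Modulo J every vector is congruent to the image of its symbol
    under the obvious section of symb ([all_reducible]), by descent on monomials:
    (i) lowers the modes and (ii) removes the modes alpha(-1) in charge one. *)

(** * Linear algebra and sums with finite support *)

Section LinearPreliminaries.
Variable F : fieldType.

(** Lets lemmas about bundled linear maps apply to functions whose linearity is
    proved on the spot. *)
Lemma linear_bundle (U W : lmodType F) (f : U -> W) :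
  linear f -> exists g : {linear U -> W}, f =1 g.
Proof.
move=> fL; pose fM := GRing.isLinear.Build _ _ _ _ f fL.
by exists (HB.pack f fM : {linear U -> W}).
Qed.

Variable U : lmodType F.

Lemma lspan_gen (S : set U) x : S x -> x \in lspan_pred S.
Proof.
move=> Sx; apply/lspanP; exists 1%N, (fun=> 1), (fun=> x).
by split=> //; rewrite big_ord1 scale1r.
Qed.

Lemma lspan_min (S : set U) (T : submodClosed U) x :
  (forall y, S y -> y \in T) -> x \in lspan_pred S -> x \in T.
Proof.
move=> ST /lspanP[n [c [y [yS ->]]]].
by apply: rpred_sum => i _; apply/rpredZ/ST.
Qed.
End LinearPreliminaries.

Section FiniteSupport.
Variable U : zmodType.

Lemma fsum_delta (I : choiceType) (S : set I) (i0 : I) (x : U) :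
  \sum_(i \in S) (if i == i0 then x else 0) = if i0 \in S then x else 0.
Proof.
case: ifP => [i0S|/negP i0S].
  rewrite (fsbigE [:: i0])//; first by rewrite big_cons big_nil i0S eqxx /= addr0.
    by move=> i /=; rewrite inE => /eqP ->; rewrite in_setE in i0S.
  by move=> i _; rewrite inE => /negPf ->.
rewrite fsbig1// => i Si; case: eqP => // ii0.
by case: i0S; rewrite in_setE -ii0.
Qed.

Lemma fsum_neg (f : int -> U) (M : nat) :
  (forall r, (M <= r)%N -> f (Negz r) = 0) ->
  \sum_(i \in [set i : int | i < 0]) f i = \sum_(r < M) f (Negz r).
Proof.
move=> f0; rewrite (fsbigE [seq Negz r | r <- iota 0 M]).
- rewrite big_map -[in iota 0 M](subn0 M) -/(index_iota 0 M) big_mkord.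
  by apply: eq_bigl => r; apply/idP; rewrite in_setE.
- by rewrite map_inj_uniq ?iota_uniq// => r r' [].
- by move=> i /= /mapP[r _ ->].
- move=> [//|r] _ rM; apply: f0; rewrite leqNgt; apply: contra rM => rM.
  by apply/mapP; exists r; rewrite // mem_iota.
Qed.

Lemma fsum_nneg (f : int -> U) (M : nat) :
  (forall r : nat, (M <= r)%N -> f r%:Z = 0) ->
  \sum_(i \in [set i : int | 0 <= i]) f i = \sum_(r < M) f r%:Z.
Proof.
move=> f0; rewrite (fsbigE [seq Posz r | r <- iota 0 M]).
- rewrite big_map -[in iota 0 M](subn0 M) -/(index_iota 0 M) big_mkord.
  by apply: eq_bigl => r; apply/idP; rewrite in_setE.
- by rewrite map_inj_uniq ?iota_uniq// => r r' [].
- by move=> i /= /mapP[r _ ->].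
- move=> [r|//] _ rM; apply: f0; rewrite leqNgt; apply: contra rM => rM.
  by apply/mapP; exists r; rewrite // mem_iota.
Qed.
End FiniteSupport.

(** * Multiplication by powers of 1 + z *)

Section BinomialTransform.
Variables (F : fieldType) (U : lmodType F).
Implicit Types (b c : int -> U) (n l : int).

(** A Laurent series sum_n b_n z^(-n-1) is encoded by its modes b_n, as a field is;
    in modes, multiplication by 1+z reads as follows. *)
Definition mul1z b : int -> U := fun n => b n + b (n + 1).

Lemma iter_mul1zE d b n :
  iter d mul1z b n = \sum_(j < d.+1) 'C(d, j)%:R *: b (n + j%:Z).
Proof.
elim: d n => [|d IH] n; first by rewrite big_ord_recl big_ord0 bin0 scale1r !addr0.
rewrite iterS /mul1z !IH.
have -> : \sum_(j < d.+1) 'C(d, j)%:R *: b (n + j%:Z) =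
          \sum_(j < d.+2) 'C(d, j)%:R *: b (n + j%:Z).
  by rewrite [RHS]big_ord_recr /= bin_small// scale0r addr0.
rewrite big_ord_recl [in RHS]big_ord_recl /= !bin0 -addrA -big_split /=.
congr (_ + _); apply: eq_bigr => i _; rewrite /bump leq0n add1n binS natrD scalerDl.
by congr (_ *: b _ + _ *: b _); lia.
Qed.

Lemma eq_mul1z_ge d b c (m : int) :
  (forall n, m <= n -> b n = c n) ->
  forall n, m <= n -> iter d mul1z b n = iter d mul1z c n.
Proof.
by move=> bc n mn; rewrite !iter_mul1zE; apply: eq_bigr => j _; rewrite bc//; lia.
Qed.

Lemma eq_mul1z d b c : b =1 c -> iter d mul1z b =1 iter d mul1z c.
Proof. by move=> bc n; apply: (@eq_mul1z_ge _ _ _ n). Qed.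

Lemma iter_mul1z_shift d b (m n : int) :
  iter d mul1z (fun k => b (k + m)) n = iter d mul1z b (n + m).
Proof. by rewrite !iter_mul1zE; apply: eq_bigr => j _; rewrite addrAC. Qed.

Lemma iter_mul1zD d b c n :
  iter d mul1z (fun k => b k + c k) n = iter d mul1z b n + iter d mul1z c n.
Proof.
by rewrite !iter_mul1zE -big_split; apply: eq_bigr => j _; rewrite scalerDr.
Qed.

Lemma iter_mul1z_sum (I : Type) (r : seq I) (P : pred I) d (f : I -> int -> U) n :
  iter d mul1z (fun k => \sum_(i <- r | P i) f i k) n =
  \sum_(i <- r | P i) iter d mul1z (f i) n.
Proof.
rewrite iter_mul1zE; under eq_bigr do rewrite scaler_sumr.
by rewrite exchange_big; apply: eq_bigr => i _; rewrite iter_mul1zE.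
Qed.

Lemma iter_mul1z_lin (g : U -> U) (gL : linear g) d b n :
  iter d mul1z (fun k => g (b k)) n = g (iter d mul1z b n).
Proof.
have g0 : g 0 = 0 by have := gL (-1) 0 0; rewrite scaler0 addr0 scaleN1r addNr.
elim: d n => //= d IH n; rewrite /mul1z !IH.
by have := gL 1 (iter d mul1z b n) (iter d mul1z b (n + 1)); rewrite !scale1r.
Qed.

(** Multiplication by (1+z)^(-q-1), expanded in positive powers of z and cut off
    after z^(M-1).  When b_n vanishes for n >= K, the cut does not affect the
    modes n >= K - M, since the terms left out involve b_(n+r) with r >= M. *)
Definition inv1z (M q : nat) b : int -> U := fun n =>
  \sum_(r < M) ((-1) ^+ r * 'C(r + q, q)%:R) *: b (n + r%:Z).

Lemma mul1z_inv1z M q b (K : int) :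
  (forall n, K <= n -> b n = 0) ->
  forall n, K <= n + M%:Z ->
  mul1z (inv1z M q b) n = if q is q'.+1 then inv1z M q' b n else b n.
Proof.
move=> bK n Kn; case: M Kn => [|M] Kn.
  rewrite /mul1z /inv1z !big_ord0 addr0.
  by case: q => [|q]; rewrite ?big_ord0// bK//; lia.
rewrite /mul1z /inv1z [X in X + _]big_ord_recl [X in _ + X]big_ord_recr /=.
rewrite [in X in _ + (_ + X)]bK ?scaler0 ?addr0; last by lia.
have E (r : nat) : n + (bump 0 r)%:Z = n + 1 + r%:Z by rewrite /bump; lia.
rewrite -addrA -big_split /= expr0 mul1r !add0n !binn scale1r.
case: q => [|q].
  rewrite big1 ?addr0// => r _; rewrite E !bin0 -scalerDl /bump leq0n exprS.
  by rewrite !mulr1 mulN1r addNr scale0r.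
rewrite big_ord_recl /= expr0 mul1r add0n binn scale1r !addr0; congr (_ + _).
apply: eq_bigr => r _; rewrite E -scalerDl; congr (_ *: b _).
rewrite /bump leq0n add1n exprS !addSn addnS binS natrD; ring.
Qed.

Lemma iter_mul1z_inv1z M q b (K : int) :
  (forall n, K <= n -> b n = 0) ->
  forall n, K <= n + M%:Z -> iter q.+1 mul1z (inv1z M q b) n = b n.
Proof.
move=> bK; elim: q => [|q IH] n Kn; first by rewrite /= (mul1z_inv1z _ bK).
rewrite iterSr -IH//; apply: (@eq_mul1z_ge _ _ _ n) => // k nk.
by rewrite (mul1z_inv1z _ bK)//; lia.
Qed.
End BinomialTransform.

(** * Exponentials of fields *)
Section ExpCoefficients.
Variable F : fieldType.
Implicit Types (x : nat -> F).

(** The coefficients of z^i in f^j and in exp f for the scalar series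
    f = sum_(n>0) x_n z^n: the scalar shadows of [opow] and [oexp]. *)
Fixpoint pow_coef x (j i : nat) : F :=
  if j is j'.+1 then \sum_(1 <= n < i.+1) x n * pow_coef x j' (i - n)
  else (i == 0%N)%:R.

Definition exp_coef x (i : nat) : F := \sum_(j < i.+1) (j`!%:R)^-1 * pow_coef x j i.

Lemma pow_coef_small x j i : (i < j)%N -> pow_coef x j i = 0.
Proof.
elim: j i => // j IH i ij /=; rewrite big_nat big1// => n /andP[n0 ni].
by rewrite IH ?mulr0//; lia.
Qed.

Lemma pow_coefE x (M : nat) : x 0%N = 0 ->
  forall j i, (i <= M)%N -> ((\poly_(n < M.+1) x n) ^+ j)`_i = pow_coef x j i.
Proof.
move=> x0; elim=> [|j IH] i iM; first by rewrite expr0 coef1.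
rewrite exprS coefM /= -(big_mkord xpredT (fun n => (\poly_(n < M.+1) x n)`_n *
  ((\poly_(n < M.+1) x n) ^+ j)`_(i - n))) big_nat_recl// coef_poly /= x0 mul0r add0r.
rewrite [RHS]big_add1 /= big_nat [RHS]big_nat; apply: eq_bigr => n ni.
rewrite coef_poly IH; last lia.
by rewrite ifT//; lia.
Qed.

(** With f = -N log(1+z), the series E = exp f satisfies (1+z) E' = -N E; the
    recursion is its coefficient of z^i.  The series f is cut off after degree i+1
    and exp after the term f^(i+1)/(i+1)!, so that formal derivatives of polynomials
    can be used. *)
Lemma exp_coef_rec x (N i : nat) : (forall n, n%:R == 0 :> F = (n == 0%N)) ->
  (forall n, x n = (-1) ^+ n * N%:R / n%:R) ->
  i.+1%:R * exp_coef x i.+1 = - (N + i)%:R * exp_coef x i.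
Proof.
move=> char0 xE.
have x0 : x 0%N = 0 by rewrite xE invr0 mulr0.
pose M := i.+1; pose f : {poly F} := \poly_(n < M.+1) x n.
pose E : {poly F} := \sum_(j < M.+1) (j`!%:R)^-1 *: f ^+ j.
have EE k : (k <= M)%N -> E`_k = exp_coef x k.
  move=> kM; rewrite /E coef_sum /exp_coef.
  under eq_bigr do rewrite coefZ pow_coefE//.
  rewrite -!(big_mkord xpredT (fun j => (j`!%:R)^-1 * pow_coef x j k)).
  rewrite (@big_cat_nat _ _ _ k.+1)//= [X in _ + X = _]big_nat [X in _ + X = _]big1 ?addr0// => j kj.
  by rewrite pow_coef_small ?mulr0//; lia.
(* E' = f' E up to the last term of the truncated exponential, which has
   valuation M and is invisible in degree i. *)
have dE : E^`() = (E - (M`!%:R)^-1 *: f ^+ M) * f^`().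
  rewrite {2}/E big_ord_recr /= addrK /E big_ord_recl derivD derivZ expr0 derivC.
  rewrite scaler0 add0r (raddf_sum (@deriv F)) /= mulr_suml; apply: eq_bigr => j _.
  rewrite derivZ deriv_exp /bump leq0n add1n /= -scalerAl [f^`() * _]mulrC.
  rewrite -[(_ * _) *+ _]scaler_nat scalerA factS natrM invfM mulrAC mulVf ?mul1r//.
  by rewrite char0.
have fE k : (k < M)%N -> f^`()`_k = (-1) ^+ k.+1 * N%:R.
  move=> kM; rewrite coef_deriv coef_poly ifT; last lia.
  by rewrite xE -[_ / _ *+ _]mulr_natr mulfVK// char0.
have fE1 k : (k < M)%N -> ((1 + 'X) * f^`())`_k = if k == 0%N then - N%:R else 0.
  move=> kM; rewrite mulrDl mul1r coefD coefXM.
  case: k kM => [|k] kM; first by rewrite addr0 fE// expr1 mulN1r.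
  by rewrite !fE /= ?exprS//; [ring | lia].
have : ((1 + 'X) * E^`())`_i = - N%:R * E`_i.
  rewrite dE mulrC -mulrA [f^`() * _]mulrC mulrC coefM big_ord_recl /= fE1// subn0.
  rewrite coefB coefZ pow_coefE// pow_coef_small// mulr0 subr0.
  rewrite big1 ?addr0// => k _; have ki := ltn_ord k.
  by rewrite fE1 ?mul0r// /bump leq0n /M; lia.
rewrite mulrDl mul1r coefD coefXM !coef_deriv [E`_i]EE//.
have -> : (if i == 0%N then 0 else E`_i.-1.+1 *+ i.-1.+1) = exp_coef x i *+ i.
  have [i0|i0] := posnP i; first by rewrite [in RHS]i0.
  by rewrite prednK// EE// ltnW.
rewrite EE// -[_ *+ i.+1]mulr_natl -[_ *+ i]mulr_natl => /(canRL (addrK _)) ->.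
by rewrite natrD; ring.
Qed.

(** exp (-(q+1) log(1+z)) = (1+z)^(-q-1), coefficientwise. *)
Lemma exp_coefE x (q i : nat) : (forall n, n%:R == 0 :> F = (n == 0%N)) ->
  (forall n, x n = (-1) ^+ n * q.+1%:R / n%:R) ->
  exp_coef x i = (-1) ^+ i * 'C(i + q, q)%:R.
Proof.
move=> char0 xE; elim: i => [|i IH].
  by rewrite /exp_coef big_ord1 /= fact0 invr1 !mul1r binn.
have /mulfI : i.+1%:R != 0 :> F by rewrite char0.
apply; rewrite (exp_coef_rec _ char0 xE) IH exprS.
have : (i.+1 * 'C(i.+1 + q, q) = (q.+1 + i) * 'C(i + q, q))%N.
  have := mul_bin_down (i.+1 + q) q.
  by rewrite addnK addSn /= => <-; congr muln; lia.
move/(congr1 (fun n : nat => n%:R : F)); rewrite !natrM => E.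
by rewrite [RHS]mulrCA E; ring.
Qed.
End ExpCoefficients.

Section Exponentials.
Variables (F : fieldType) (N : nat).
Local Notation VL := {malg F[idx]}.

(** If a linear map turns every X_n into a scalar x_n, it turns exp (sum X_n z^n)
    into the scalar series exp (sum x_n z^n). *)
Lemma oexp_eigen (W : lmodType F) (g : {linear VL -> W}) (P : pred int)
    (X : nat -> VL -> VL) (x : nat -> F) :
  (forall n, keeps P (X n)) ->
  {in charges P, forall w n, (0 < n)%N -> g (X n w) = x n *: g w} ->
  {in charges P, forall w i, g (oexp X i w) = exp_coef x i *: g w}.
Proof.
move=> PX gX w Pw i.
have ow j k : opow X j k w \in charges P /\ g (opow X j k w) = pow_coef x j k *: g w.
  elim: j k => [|j IH] k /=.
    by case: eqP => _; rewrite ?rpred0 ?raddf0 ?scale1r ?scale0r.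
  split; first by apply: rpred_sum => n _; apply/PX/(IH _).1.
  rewrite raddf_sum scaler_suml big_nat [RHS]big_nat; apply: eq_bigr => n nk.
  by rewrite /= gX ?(IH _).1 ?(IH _).2 ?scalerA//; lia.
rewrite /oexp raddf_sum scaler_suml; apply: eq_bigr => j _.
by rewrite /= linearZ_LR /= (ow _ _).2 scalerA.
Qed.
End Exponentials.

(** * The symbol map *)
Section Symbol.
Variables (F : fieldType) (N : nat).
Local Notation VL := {malg F[idx]}.
Local Notation xyalg := (xyalg F N).
Implicit Types (k : idx) (v w : VL).

HB.instance Definition _ (m : int) := GRing.Linear.copy (@eshift F m) (linext _).
HB.instance Definition _ (B : pred idx) := GRing.Linear.copy (@bpart F B) (linext _).
HB.instance Definition _ (m l : int) :=
  GRing.Linear.copy (@zpow F N m l) (bpart _).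

Lemma bpart_bas (B : pred idx) k : bpart B (bas F k) = if B k then bas F k else 0.
Proof. exact: linext_bas. Qed.

Lemma zpow_bas (m l : int) k :
  zpow N m l (bas F k) = if (2 * N)%:Z * m * k.2 == l then bas F k else 0.
Proof. exact: bpart_bas. Qed.

Lemma eshift_bas (m : int) k : eshift m (bas F k) = bas F (k.1, m + k.2).
Proof. exact: linext_bas. Qed.

Lemma eq_on_bas (W : lmodType F) (g h : VL -> W) v : linear g -> linear h ->
  {in msupp v, forall k, g (bas F k) = h (bas F k)} -> g v = h v.
Proof.
move=> /linear_bundle[G gG] /linear_bundle[H hH] gh; rewrite gG hH [v]malg_basE !raddf_sum.
rewrite big_seq [RHS]big_seq; apply: eq_bigr => k kv /=.
by rewrite !linearZ_LR -gG -hH gh.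
Qed.

(** The class of e^(p alpha) in the Zhu algebra. *)
Definition symb_top (p : int) : xyalg :=
  if p == 0 then 1 else if p == 1 then xyY F N else 0.

(** The candidate for the quotient map onto the Zhu algebra: relation (i) turns
    alpha(-i-1) into (-1)^i alpha(-1), and alpha(-1) acts on classes as right
    multiplication by x. *)
Definition symb : VL -> xyalg := linext (fun k =>
  (\prod_(i <- (k.1 : seq nat)) (-1) ^+ i) *: (symb_top k.2 * xyX F N ^+ size k.1)).
HB.instance Definition _ := GRing.Linear.copy symb (linext _).

Lemma symb_bas k : symb (bas F k) =
  (\prod_(i <- (k.1 : seq nat)) (-1) ^+ i) *: (symb_top k.2 * xyX F N ^+ size k.1).
Proof. exact: linext_bas. Qed.

Lemma symb_create i w :
  symb (heis N (Negz i) w) = (-1) ^+ i *: (symb w * xyX F N).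
Proof.
pose g w := symb (heis N (Negz i) w).
pose h w := (-1) ^+ i *: (symb w * xyX F N).
rewrite -[LHS]/(g w) -[RHS]/(h w); apply: eq_on_bas => [a u v|a u v|k _].
- by rewrite /g !linearP.
- by rewrite /h linearP mulrDl -scalerAl linearP.
rewrite /g /h heis_basE !symb_bas (perm_big _ (perm_mset1D i k.1)) /= big_cons.
by rewrite (perm_size (perm_mset1D i k.1)) exprSr mulrA -scalerAl scalerA.
Qed.

(** In charge p the two multiplications by x differ by the eigenvalue 2Np of
    alpha(0): this vanishes for p = 0, and xy - yx = 2N y for p = 1. *)
Lemma xyX_symb w : xyX F N * symb w = symb w * xyX F N + symb (heis N 0 w).
Proof.
pose g w := xyX F N * symb w.
pose h w := symb w * xyX F N + symb (heis N 0 w).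
rewrite -[LHS]/(g w) -[RHS]/(h w); apply: eq_on_bas => [a u v|a u v|k _].
- by rewrite /g linearP mulrDr scalerAr.
- by rewrite /h !linearP mulrDl -scalerAl /= scalerDr addrACA.
rewrite /g /h heis_basE linearZ_LR /= symb_bas -scalerAl -scalerAr.
rewrite scalerA mulrC -scalerA -scalerDr; congr (_ *: _).
rewrite /symb_top; case: eqP => [->|_].
  by rewrite mul1r -exprS exprSr mulr0 scale0r addr0.
case: eqP => [->|_]; last by rewrite !(mul0r, mulr0) scaler0 addr0.
rewrite mulrA xyXY -mulrA -exprSr exprS [xyY _ _ * (_ * _)]mulrA xyYX -!scalerAl.
by rewrite -scalerDl; congr (_ *: _); rewrite natrM; ring.
Qed.

Lemma symb_charges2 w : w \in charges (fun m : int => 2 <= m) -> symb w = 0.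
Proof.
move=> /allP w2; rewrite -[RHS](raddf0 (\0 : VL -> xyalg)).
apply: (@eq_on_bas _ _ \0) => [a u v|a u v|k /w2 /= k2]; first by rewrite linearP.
  by rewrite scaler0 addr0.
rewrite symb_bas /symb_top; case: eqP => [?|_]; first lia.
by case: eqP => [?|_]; [lia | rewrite mul0r scaler0].
Qed.

(** In charge one this is y x = -N y; symbols of larger charge vanish. *)
Lemma symb_charges1_X w : w \in charges (fun m : int => 1 <= m) ->
  symb w * xyX F N = - N%:R *: symb w.
Proof.
move=> /allP w1; pose g w := symb w * xyX F N.
pose h w := - N%:R *: symb w.
rewrite -[LHS]/(g w) -[RHS]/(h w); apply: eq_on_bas => [a u v|a u v|k /w1 /= k1].
- by rewrite /g linearP mulrDl -scalerAl.
- by rewrite /h linearP scalerDr !scalerA mulrC.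
rewrite /g /h symb_bas -scalerAl [RHS]scalerA mulrC -scalerA; congr (_ *: _).
rewrite /symb_top; case: eqP => [?|_]; first lia.
case: eqP => [_|_]; last by rewrite !mul0r scaler0.
by rewrite -mulrA -exprSr exprS mulrA xyYX -!scalerAl.
Qed.

(** On V_B, z^alpha is z^0 in charge zero only; from charge one on, e_alpha
    leads to charges at least two, where symbols vanish, matching y^2 = 0. *)
Lemma symb_shift l v : (0 < N)%N -> v \in charges nonneg ->
  symb (eshift 1 (zpow N 1 l v)) = if l == 0 then xyY F N * symb v else 0.
Proof.
move=> N0 /allP v0; pose g v := symb (eshift 1 (zpow N 1 l v)).
pose h v := if l == 0 then xyY F N * symb v else 0.
rewrite -[LHS]/(g v) -[RHS]/(h v); apply: eq_on_bas => [a u w|a u w|k /v0 /= k0].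
- by rewrite /g !linearP.
- by rewrite /h; case: eqP => _; rewrite ?scaler0 ?addr0// linearP mulrDr scalerAr.
rewrite /g /h zpow_bas.
have k0' : 0 <= k.2 by [].
have E : k.2 != 0 -> symb (eshift 1 (bas F k)) = 0.
  move=> k1; rewrite symb_charges2// eshift_bas charges_bas//=.
  by lia.
have E' : k.2 != 0 -> xyY F N * symb (bas F k) = 0.
  move=> k1; rewrite symb_bas /symb_top (negPf k1); case: eqP => _.
    by rewrite -scalerAr mulrA xyYY mul0r scaler0.
  by rewrite mul0r scaler0 mulr0.
have [kz|kz] := eqVneq k.2 0.
  rewrite kz mulr0 eq_sym; case: eqP => _; last by rewrite !raddf0.
  rewrite eshift_bas !symb_bas /= kz addr0 /symb_top /=.
  by rewrite mul1r scalerAr.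
have -> : symb (eshift 1 (if (2 * N)%:Z * 1 * k.2 == l then bas F k else 0)) = 0.
  by case: ifP => _; rewrite ?E// !raddf0.
by case: ifP => _; rewrite ?E'.
Qed.
End Symbol.

(** * Truncation of fields *)
Section Fields.
Variables (F : fieldType) (N : nat).
Local Notation VL := {malg F[idx]}.
Implicit Types (k : idx) (v w : VL) (D : nat).

Definition osc_degree (s : {mset nat}) : nat := \sum_(i <- (s : seq nat)) i.+1.

Lemma osc_degree1D i s : osc_degree (i +` s)%mset = (i.+1 + osc_degree s)%N.
Proof. by rewrite /osc_degree (perm_big _ (perm_mset1D i s)) big_cons. Qed.

(** Induction on monomials: a property of all monomials follows from the monomials
    in alpha(-1) alone when it can be transported from alpha(-i-1)u to
    alpha(-i-2)u, because the latter has larger degree. *)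
Lemma mset_descent (P : {mset nat} -> Prop) :
  (forall n, P (msetn n 0%N)) ->
  (forall i t, P (i +` t)%mset -> P (i.+1 +` t)%mset) -> forall s, P s.
Proof.
move=> P0 PS s; have [m] := ubnP (osc_degree s); elim: m s => // m IH s sm.
have [[i si]|s0] := pselect (exists i, i.+1 \in s).
  rewrite -(msetB1K si); apply/PS/IH.
  by move: sm; rewrite -{1}(msetB1K si) !osc_degree1D; lia.
have -> : s = msetn (s 0%N) 0%N; last exact: P0.
apply/msetP => -[|x]; rewrite msetnE//=.
by have [//|sx] := posnP (s x.+1); case: s0; exists x; rewrite in_mset.
Qed.

(** Vectors of oscillator degree less than D.  The strict bound makes the zeroth
    subspace trivial, so that lowering the degree often enough gives zero. *)
Definition below D : {pred VL} :=
  fun v => all (fun k => osc_degree k.1 < D)%N (msupp v).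

Lemma below_submod D : submod_closed (below D).
Proof.
split=> [|c u v /allP Du /allP Dv]; first by rewrite /below unfold_in msupp0.
apply/allP=> k /(fsubsetP (msuppD_le _ _)) /fsetUP[]; last exact: Dv.
by move/(fsubsetP (msuppZ_le _ _)); apply: Du.
Qed.
HB.instance Definition _ D :=
  GRing.isSubmodClosed.Build F VL (below D) (below_submod D).

Lemma below_bas D k : (osc_degree k.1 < D)%N -> bas F k \in below D.
Proof. by move=> Dk; apply/allP=> i; rewrite msuppU oner_eq0 inE => /eqP->. Qed.

Lemma below0 v : v \in below 0 -> v = 0.
Proof.
move=> /allP v0; rewrite [v]malg_basE big_seq big1// => k /v0; by rewrite ltn0.
Qed.

Lemma exists_below v : exists D, v \in below D.
Proof.
exists (\max_(k <- msupp v) osc_degree k.1).+1; apply/allP => k kv.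
rewrite ltnS.
exact: (@leq_bigmax_seq _ (enum_fset (msupp v)) xpredT (fun k => osc_degree k.1)).
Qed.

Lemma below_linext D D' f v :
  (forall k, (osc_degree k.1 < D)%N -> f k \in below D') ->
  v \in below D -> linext f v \in below D'.
Proof.
move=> fD /allP Dv; rewrite /linext big_seq; apply: rpred_sum => k /Dv Dk.
by apply/rpredZ/fD.
Qed.

Lemma heis_below D (n : nat) v :
  v \in below D -> heis N n%:Z v \in below (D - n).
Proof.
apply: below_linext => -[s p] /= sD.
case: n => [|i]; first by rewrite subn0 rpredZ// below_bas.
have [->|si] := posnP (s i); first by rewrite muln0 scale0r rpred0.
rewrite rpredZ// below_bas//=.
by move: sD; rewrite -{1}(@msetB1K _ i s) ?in_mset// osc_degree1D; lia.
Qed.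

Lemma oexp_below (X : nat -> VL -> VL) :
  (forall n D w, w \in below D -> X n w \in below (D - n)) ->
  forall i D w, w \in below D -> oexp X i w \in below (D - i).
Proof.
move=> XD i D w wD; apply: rpred_sum => j _; apply: rpredZ.
move: (j : nat) => l; elim: l i {j} => [|l IH] i /=.
  by case: eqP => [->|_]; rewrite ?subn0 ?rpred0.
rewrite big_nat; apply: rpred_sum => n ni.
have -> : (D - i = D - (i - n) - n)%N by lia.
exact/XD/IH.
Qed.

Lemma exppos_below m i D w : w \in below D -> exppos N m i w \in below (D - i).
Proof. by apply: oexp_below => n D' w' wD; apply/rpredZ/heis_below. Qed.

(** If all X_n with n > 0 kill w, only the zeroth term of the exponential
    contributes. *)
Lemma oexp_kill (X : nat -> VL -> VL) i w : (forall n, X n 0 = 0) ->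
  (forall n, (0 < n)%N -> X n w = 0) -> oexp X i w = if i == 0%N then w else 0.
Proof.
move=> X0 Xw.
have opow0 l j : opow X l.+1 j w = 0.
  elim: l j => [|l IH] j; rewrite /= big_nat big1// => n /andP[n0 _].
    by case: ifP => _; rewrite ?Xw.
  by have /= -> := IH (j - n)%N.
rewrite /oexp big_ord_recl big1 => [|j _]; last by rewrite [opow _ _ _ _]opow0 scaler0.
by rewrite fact0 invr1 scale1r addr0.
Qed.

Lemma oexp_0 (X : nat -> VL -> VL) i : (forall n, X n 0 = 0) -> oexp X i 0 = 0.
Proof. by move=> X0; rewrite oexp_kill ?if_same. Qed.

Lemma expneg_0 m i : expneg N m i (0 : VL) = 0.
Proof. by apply: oexp_0 => n; rewrite raddf0 scaler0. Qed.

Lemma exppos_0 m i : exppos N m i (0 : VL) = 0.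
Proof. by apply: oexp_0 => n; rewrite raddf0 scaler0. Qed.

Lemma zpow_below m l D v : v \in below D -> zpow N m l v \in below D.
Proof.
by apply: below_linext => k kD; case: ifP => _; rewrite ?rpred0 ?below_bas.
Qed.

Lemma eshift_below m D v : v \in below D -> eshift m v \in below D.
Proof. by apply: below_linext => k kD; rewrite below_bas. Qed.

Lemma zpow_out m l v : l \notin [seq (2 * N)%:Z * m * k.2 | k <- msupp v] ->
  zpow N m l v = 0.
Proof.
move=> lL; rewrite /zpow /bpart /linext big_seq big1// => k kv.
case: eqP => [E|_]; last by rewrite scaler0.
by case/negP: lL; apply/mapP; exists k.
Qed.

(** The field property B_n v = 0 for large n; B_n 0 = 0 is recorded separately since
    the modes B_n are bare functions, not bundled linear maps. *)
Definition lower_truncated (B : vfield F) : Prop :=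
  (forall n, B n 0 = 0) /\ forall v, exists K : nat, forall n : int, K%:Z <= n -> B n v = 0.

(** The sum defining a mode of Y(e^(m alpha),z) ranges over an infinite set of
    triples; only finitely many l occur as powers of z^(m alpha) on v, and the
    annihilation exponential is a polynomial on v, so the sum is finite.  The range
    of x is uniform in n >= n0, which allows it to be compared with [inv1z]. *)
Lemma Yexp_expansion m v (n0 : int) : exists (M0 : nat) (L : seq int),
  [/\ uniq L, 0 \in L & forall (M : nat) (n : int), (M0 <= M)%N -> n0 <= n ->
    Yexp N m n v = \sum_(x < M) \sum_(l <- L)
      if 0 <= x%:Z + l + n + 1 then
        expneg N m x (exppos N m (absz (x%:Z + l + n + 1)) (eshift m (zpow N m l v)))
      else 0].
Proof.
have [D vD] := exists_below v.
pose L : seq int := undup (0 :: [seq (2 * N)%:Z * m * k.2 | k <- msupp v]).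
pose Lb := (\max_(l <- L) `|l|%N)%N.
have lLb l : l \in L -> (`|l| <= Lb)%N.
  by move=> lL; apply: (@leq_bigmax_seq _ L xpredT absz).
exists (D + Lb + `|n0|)%N, L; split=> [||M n M0M n0n]; first exact: undup_uniq.
  by rewrite mem_undup mem_head.
pose f (t : nat * nat * int) :=
  expneg N m t.1.1 (exppos N m t.1.2 (eshift m (zpow N m t.2 v))).
pose h (x : nat) (l : int) : nat * nat * int := (x, absz (x%:Z + l + n + 1), l).
pose P (t : nat * nat * int) := t.1.1%:Z - t.1.2%:Z + t.2 == - n - 1.
have -> : Yexp N m n v = \sum_(t \in [set` P]) f t.
  by apply: eq_fsbigl; apply/seteqP; split=> t /=; rewrite unfold_in => /eqP.
have key (x y : nat) (l : int) : x%:Z - y%:Z + l = - n - 1 -> (y < D)%N ->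
    (`|l| <= Lb)%N -> (x < M)%N /\ y = absz (x%:Z + l + n + 1) by lia.
rewrite -(@bigfs _ _ _ _ [seq h x l | x <- iota 0 M, l <- L]); first last.
- move=> -[[x y] l]; rewrite unfold_in /= => /eqP E tL; rewrite /f /=.
  have [lL|lL] := boolP (l \in L); last first.
    rewrite zpow_out ?raddf0 ?exppos_0 ?expneg_0//.
    by apply: contra lL => lL; rewrite mem_undup inE lL orbT.
  have [Dy|yD] := leqP D y.
    have -> : exppos N m y (eshift m (zpow N m l v)) = 0; last exact: expneg_0.
    apply: below0; have -> : (0 = D - y)%N by lia.
    exact/exppos_below/eshift_below/zpow_below.
  case/negP: tL; apply/allpairsP; exists (x, l); split=> //=.
    by rewrite mem_iota add0n (key _ _ _ E yD (lLb l lL)).1.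
  by rewrite /h -(key _ _ _ E yD (lLb l lL)).2.
- apply: allpairs_uniq; [exact: iota_uniq | exact: undup_uniq |].
  by move=> [x l] [x' l'] _ _ [-> _ ->].
rewrite big_mkcond big_allpairs_dep -[in iota 0 M](subn0 M) -/(index_iota 0 M).
rewrite big_mkord; apply: eq_bigr => x _; apply: eq_bigr => l _.
rewrite /P /f /=; case: ifP => [/eqP E|/eqP E].
  by rewrite ifT//; lia.
by rewrite ifF//; lia.
Qed.

Lemma Yexp_truncated m : lower_truncated (Yexp N m).
Proof.
split=> [n|v].
  rewrite /Yexp fsbig1// => t _.
  by rewrite !raddf0 exppos_0 expneg_0.
have [D vD] := exists_below v.
pose L : seq int := [seq (2 * N)%:Z * m * k.2 | k <- msupp v].
pose Lb := (\max_(l <- L) `|l|%N)%N.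
have lLb l : l \in L -> (`|l| <= Lb)%N.
  by move=> lL; apply: (@leq_bigmax_seq _ L xpredT absz).
exists (D + Lb)%N => n Kn; rewrite /Yexp fsbig1// => -[[x y] l] /= E.
have [/lLb lL|lL] := boolP (l \in L); last first.
  by rewrite zpow_out// !raddf0 exppos_0 expneg_0.
have -> : exppos N m y (eshift m (zpow N m l v)) = 0; last exact: expneg_0.
apply: below0; have -> : (0 = D - y)%N by lia.
exact/exppos_below/eshift_below/zpow_below.
Qed.
End Fields.

(** * Symbols of vertex operators *)
Section FieldsModO.
Variables (F : fieldType) (N : nat).
Local Notation VL := {malg F[idx]}.
Local Notation xyalg := (xyalg F N).
Local Notation mul1z := (@mul1z F xyalg).
Local Notation symb := (@symb F N).
Local Notation xyX := (xyX F N).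
Implicit Types (k : idx) (v w : VL) (B : vfield F).

(** The series symb ((1+z)^d B(z) v), for every v in V_B, has constant term
    c symb(v) and no term of positive degree: the mode -l-1 is the coefficient of
    z^l. *)
Definition has_symbol B (d : nat) (c : xyalg) : Prop :=
  {in charges nonneg, forall v (l : nat),
    iter d mul1z (fun n => symb (B n v)) (- l%:Z - 1) =
      if l == 0%N then c * symb v else 0}.

Lemma Yexp0E n v : Yexp N 0 n v = if n == -1 then v else 0.
Proof.
have negE i w : expneg N 0 i w = if i == 0%N then w else 0 :> VL.
  by apply: oexp_kill => j *; rewrite mul0r scale0r.
have posE i w : exppos N 0 i w = if i == 0%N then w else 0 :> VL.
  by apply: oexp_kill => j *; rewrite mul0r oppr0 scale0r.
have shE w : eshift 0 w = w :> VL.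
  by rewrite /eshift [RHS]malg_basE; apply: eq_bigr => -[s p] _ /=; rewrite add0r.
have zE l w : zpow N 0 l w = if l == 0 then w else 0 :> VL.
  rewrite /zpow /bpart /linext; under eq_bigr => k _ do rewrite mulr0 mul0r eq_sym.
  case: eqP => _; first by rewrite -malg_basE.
  by rewrite big1// => k _; rewrite scaler0.
have termE (t : nat * nat * int) :
    expneg N 0 t.1.1 (exppos N 0 t.1.2 (eshift 0 (zpow N 0 t.2 v))) =
    if t == (0%N, 0%N, 0) then v else 0.
  by case: t => [[[|x] [|y]] [[|l]|l]]; rewrite !(negE, posE, shE, zE).
have -> : Yexp N 0 n v = \sum_(t \in [set t : nat * nat * int |
    t.1.1%:Z - t.1.2%:Z + t.2 = - n - 1]) if t == (0%N, 0%N, 0) then v else 0.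
  by apply: eq_fsbigr => t _; apply: termE.
case: eqP => [->|n1]; last first.
  rewrite fsbig1// => t /= tn; case: eqP => // t0.
  by rewrite t0 /= in tn; lia.
rewrite (fsbigE [:: (0%N, 0%N, 0 : int)])//=; first last.
- by move=> t _; rewrite inE => /negPf ->.
- by move=> t /=; rewrite inE => /eqP ->.
by rewrite big_cons big_nil eqxx addr0 ifT// in_setE.
Qed.

Lemma has_symbol_Yexp0 : has_symbol (Yexp N 0) 0 1.
Proof.
move=> v _ l /=; rewrite Yexp0E mul1r.
have -> : (- l%:Z - 1 == -1 :> int) = (l == 0%N) by lia.
by case: eqP => _; rewrite ?raddf0.
Qed.

Lemma Yexp_charges m (P Q : pred int) : {homo +%R m : p / P p >-> Q p} ->
  forall n v, v \in charges P -> Yexp N m n v \in charges Q.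
Proof.
move=> PQ n v Pv; apply: rpred_sum => t _.
apply: keeps_oexp => [i u Pu|]; first by apply/rpredZ/keeps_heis.
apply: keeps_oexp => [i u Pu|]; first by apply/rpredZ/keeps_heis.
apply: (charges_linext (P := P)); last exact: keeps_bpart.
by move=> k Pk; apply/charges_bas/PQ.
Qed.

Lemma has_symbol_Yexp2 m d : 2 <= m -> has_symbol (Yexp N m) d 0.
Proof.
move=> m2 v v0 l; rewrite mul0r if_same iter_mul1zE big1// => j _.
rewrite symb_charges2 ?scaler0//; apply: Yexp_charges v0 => p /=.
by rewrite /nonneg; lia.
Qed.

Hypothesis char0 : forall n, n%:R == 0 :> F = (n == 0%N).
Hypothesis N_gt0 : (0 < N)%N.

(** On charge one alpha(-n) has symbol (-1)^(n-1) times -N, so the creation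
    exponential becomes exp (-N log(1+z)) = (1+z)^(-N) and cancels the weight factor.
    The annihilation exponential is 1 plus negative powers of z. *)
Lemma has_symbol_Yexp1 : has_symbol (Yexp N 1) N (xyY F N).
Proof.
move=> v v0 l.
pose w := eshift 1 (zpow N 1 0 v).
have [D wD] : exists D, w \in below D by exact: exists_below.
(* modes of the symbol of the annihilation exponential *)
pose b (k : int) : xyalg :=
  if 0 <= k + 1 then symb (exppos N 1 (absz (k + 1)) w) else 0.
have bD (k : int) : D%:Z <= k -> b k = 0.
  move=> Dk; rewrite /b; case: ifP => // _.
  suff -> : exppos N 1 (absz (k + 1)) w = 0 by rewrite raddf0.
  apply: below0; have -> : (0 = D - absz (k + 1)%R)%N by lia.
  exact: exppos_below.
have [M0 [L [uL L0 YE]]] := Yexp_expansion N 1 v (- l%:Z - 1).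
pose M := (M0 + D + l.+1)%N.
have keepX i : keeps (fun m : int => 1 <= m)
    (fun v => (1%:~R / i%:R) *: heis N (- i%:Z) v : VL).
  by move=> u Pu; apply/rpredZ/keeps_heis.
have keepXp P i : keeps P (fun v => - (1%:~R / i%:R) *: heis N i%:Z v : VL).
  by move=> u Pu; apply/rpredZ/keeps_heis.
have shc l' : eshift 1 (zpow N 1 l' v) \in charges (fun m : int => 1 <= m).
  apply: (charges_linext (P := nonneg)); last exact: keeps_bpart.
  by move=> k; rewrite /nonneg => Pk; apply/charges_bas => /=; lia.
have shc2 l' : l' != 0 -> eshift 1 (zpow N 1 l' v) \in charges (fun m : int => 2 <= m).
  move=> l0; rewrite /zpow /bpart /linext raddf_sum big_seq; apply: rpred_sum => k kv.
  rewrite /= linearZ_LR /= rpredZ//; case: eqP => [E|_]; last by rewrite raddf0 rpred0.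
  have k0 : 0 <= k.2 by have /allP := v0; apply.
  have k1 : k.2 != 0 by apply: contraNneq l0 => k0'; rewrite -E k0' mulr0.
  by rewrite eshift_bas charges_bas//=; lia.
pose x (n : nat) : F := (-1) ^+ n * N.-1.+1%:R / n%:R.
have symb_neg u r : u \in charges (fun m : int => 1 <= m) ->
    symb (expneg N 1 r u) = ((-1) ^+ r * 'C(r + N.-1, N.-1)%:R) *: symb u.
  move=> u1; rewrite -(@exp_coefE _ x)//.
  apply: (oexp_eigen keepX) => // {}u {}u1 [//|n] _.
  rewrite linearZ_LR /= -NegzE symb_create symb_charges1_X// !scalerA.
  by congr (_ *: _); rewrite /x prednK// exprS; ring.
have -> : iter N mul1z (fun n => symb (Yexp N 1 n v)) (- l%:Z - 1) =
          iter N mul1z (inv1z M N.-1 b) (- l%:Z - 1).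
  apply: (@eq_mul1z_ge _ _ _ _ _ (- l%:Z - 1)) => // n nl.
  rewrite (YE M)//; last by rewrite /M; lia.
  rewrite raddf_sum; apply: eq_bigr => r _ /=.
  rewrite raddf_sum (bigD1_seq 0)//= big1 ?addr0; last first.
    move=> l' l0; case: ifP => _; last exact: raddf0.
    have e2 : exppos N 1 (absz (r%:Z + l' + n + 1)) (eshift 1 (zpow N 1 l' v))
        \in charges (fun m : int => 2 <= m).
      by apply: keeps_oexp; [exact: keepXp | exact: shc2].
    rewrite symb_neg ?symb_charges2 ?scaler0//.
    by apply: keeps_oexp; [exact: keepXp | exact: shc].
  rewrite /b [n + _]addrC; case: ifP => _; last by rewrite raddf0 scaler0.
  by rewrite symb_neg//; apply: keeps_oexp; [exact: keepXp | exact: shc].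
have := @iter_mul1z_inv1z _ _ M N.-1 _ _ bD (- l%:Z - 1).
rewrite (prednK N_gt0) => ->; last by rewrite /M; lia.
rewrite /b; case: l {M YE} => [|l] /=.
  by rewrite /exppos /oexp big_ord1 /= invr1 scale1r symb_shift.
by [].
Qed.

Lemma has_symbol_Yexp m : 0 <= m ->
  has_symbol (Yexp N m) (N * absz m ^ 2) (symb_top F N m).
Proof.
move=> m0; rewrite /symb_top; case: eqP => [->|m_neq0].
  by rewrite muln0; apply: has_symbol_Yexp0.
case: eqP => [->|m_neq1]; first by rewrite muln1; apply: has_symbol_Yexp1.
by apply: has_symbol_Yexp2; lia.
Qed.
End FieldsModO.

Section NormallyOrdered.
Variables (F : fieldType) (N : nat).
Hypothesis char0 : forall n, n%:R == 0 :> F = (n == 0%N).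
Local Notation VL := {malg F[idx]}.
Local Notation xyalg := (xyalg F N).
Local Notation mul1z := (@mul1z F xyalg).
Local Notation symb := (@symb F N).
Local Notation xyX := (xyX F N).
Implicit Types (k : idx) (v w : VL) (A B : vfield F).

Lemma fdivderiv_neg q A (r : nat) v :
  fdivderiv q A (Negz r) v = 'C(r + q, q)%:R *: A (Negz (r + q)) v.
Proof.
have E : iter q (@fderiv F) A (Negz r) v = ((r + q) ^_ q)%:R *: A (Negz (r + q)) v.
  elim: q r => [|q IH] r; first by rewrite addn0 ffactn0 scale1r.
  rewrite iterS /fderiv.
  have -> : Negz r - 1 = Negz r.+1 by lia.
  rewrite IH scalerA addSnnS; congr (_ *: _).
  rewrite NegzE opprK ffactnSr -addSnnS natrM.
  have -> : (r.+1 + q - q = r.+1)%N by lia.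
  by rewrite mulrC.
rewrite /fdivderiv E scalerA -bin_ffact natrM mulrC mulfK//.
by rewrite char0 -lt0n fact_gt0.
Qed.

(** The binomial coefficient kills the modes 0 <= r < q: a q-th derivative has no
    z^(-1), ..., z^(-q) terms. *)
Lemma fdivderiv_nneg q A (r : nat) v :
  fdivderiv q A r%:Z v = ((-1) ^+ q * 'C(r, q)%:R) *: A (r%:Z - q%:Z) v.
Proof.
have E : iter q (@fderiv F) A r%:Z v = ((-1) ^+ q * (r ^_ q)%:R) *: A (r%:Z - q%:Z) v.
  elim: q r => [|q IH] r; first by rewrite subr0 ffactn0 mul1r scale1r.
  rewrite iterS /fderiv; case: r => [|r].
    by rewrite oppr0 ffact0n mulr0 !scale0r.
  have -> : r.+1%:Z - 1 = r%:Z by lia.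
  rewrite IH scalerA ffactSS natrM exprS.
  by congr (_ *: A _ v); [rewrite mulrNz; ring | lia].
rewrite /fdivderiv E scalerA -bin_ffact natrM; congr (_ *: _).
by rewrite mulrC -mulrA mulfK// char0 -lt0n fact_gt0.
Qed.

Lemma divderiv_heis_truncated q : lower_truncated (fdivderiv q (@heis F N)).
Proof.
split=> [n|v].
  case: n => n; first by rewrite fdivderiv_nneg raddf0 scaler0.
  by rewrite fdivderiv_neg raddf0 scaler0.
have [D vD] := exists_below v; exists (D + q)%N => -[] // n Dn.
rewrite fdivderiv_nneg.
have -> : n%:Z - q%:Z = (n - q)%N%:Z by lia.
suff -> : heis N (n - q)%N%:Z v = 0 by rewrite scaler0.
apply: below0; have -> : (0 = D - (n - q))%N by lia.
exact: heis_below.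
Qed.

Lemma nop_expansion A B v (n0 : int) :
  lower_truncated A -> lower_truncated B ->
  exists (M0 : nat), forall (M T : nat) (n : int), (M0 <= M)%N -> (M0 <= T)%N -> n0 <= n ->
    nop A B n v = \sum_(r < M) A (Negz r) (B (n + r%:Z) v)
      + \sum_(i < T) B (n - i%:Z - 1) (A i%:Z v).
Proof.
move=> [A0 /(_ v)[KA KAv]] [B0 /(_ v)[KB KBv]].
exists (KA + KB + absz n0)%N => M T n M0M M0T n0n; rewrite /nop; congr (_ + _).
  rewrite (@fsum_neg _ _ M) => [|r Mr]; last by rewrite KBv ?A0//; lia.
  by apply: eq_bigr => r _; congr (A _ (B _ v)); lia.
by rewrite (@fsum_nneg _ _ T)// => r Tr; rewrite KAv ?B0//; lia.
Qed.

(** Only finitely many annihilation modes A_i act nontrivially on v, and each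
    A_i v has its own truncation bound for B, so a maximum of bounds works. *)
Lemma nop_truncated A B :
  lower_truncated A -> lower_truncated B -> lower_truncated (nop A B).
Proof.
move=> tA tB; have [A0 Av] := tA; have [B0 Bv] := tB; split=> [n|v].
  by rewrite /nop !fsbig1 ?addr0// => i _; rewrite ?A0 ?B0// A0.
have [KA KAv] := Av v; have [KB KBv] := Bv v.
have [K KP] : exists K : nat, forall (i : 'I_KA) (n : int), K%:Z <= n -> B n (A i%:Z v) = 0.
  have Bi (i : 'I_KA) : exists K : nat, forall n : int, K%:Z <= n -> B n (A i%:Z v) = 0.
    exact: Bv.
  have [f fP] := choice Bi; exists (\max_(i < KA) f i)%N => i n Kn; apply: fP.
  by apply: le_trans Kn; rewrite lez_nat leq_bigmax.
exists (KB + K + KA)%N => n Kn; rewrite /nop fsbig1 ?add0r.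
  rewrite (@fsum_nneg _ _ KA) => [|r Kr]; last by rewrite KAv ?B0//; lia.
  by rewrite big1// => i _; rewrite KP//; have := ltn_ord i; lia.
by move=> i /= i0; rewrite KBv ?A0//; lia.
Qed.

(** The creation half of A has symbol (-1)^q (1+z)^(-q-1) times right multiplication
    by x, so the new factor (1+z)^(q+1) cancels.  In the annihilation half, A_i has
    a pole of order i+1 > q+1 unless i <= q, and the modes i < q vanish; so after
    multiplication by (1+z)^(q+1) only i = q, that is alpha(0), reaches the
    constant term. *)
Lemma has_symbol_nop q B d c : lower_truncated B -> has_symbol B d c ->
  has_symbol (nop (fdivderiv q (heis N)) B) (q.+1 + d) ((-1) ^+ q *: (c * xyX)).
Proof.
move=> tB Bc v v0 l; set A := fdivderiv q (heis N).
have tA : lower_truncated A := divderiv_heis_truncated q.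
have [K KBv] := tB.2 v.
have [M0 nopE] := nop_expansion v (- l%:Z - 1) tA tB.
pose M := (M0 + K + l.+1)%N; pose T := (M0 + q.+1)%N.
pose b n := symb (B n v).
have bK n : K%:Z <= n -> b n = 0 by move=> Kn; rewrite /b KBv ?raddf0.
pose rmulX (y : xyalg) := (-1) ^+ q *: (y * xyX).
have rmulXL : linear rmulX.
  by move=> a y z; rewrite /rmulX mulrDl -scalerAl scalerDr !scalerA mulrC.
have -> : iter (q.+1 + d) mul1z (fun n => symb (nop A B n v)) (- l%:Z - 1) =
  iter (q.+1 + d) mul1z (fun n => rmulX (inv1z M q b n) +
    \sum_(i < T) symb (B (n - i%:Z - 1) (A i%:Z v))) (- l%:Z - 1).
  apply: (@eq_mul1z_ge _ _ _ _ _ (- l%:Z - 1)) => // n nl.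
  rewrite (nopE M T) /M /T//; [|lia|lia].
  rewrite raddfD !raddf_sum; congr (_ + _).
  rewrite /rmulX /inv1z mulr_suml scaler_sumr; apply: eq_bigr => r _ /=.
  rewrite /A fdivderiv_neg linearZ_LR /= symb_create scalerA -scalerAl scalerA.
  by congr (_ *: _); rewrite exprD; ring.
rewrite iter_mul1zD (iter_mul1z_lin rmulXL _ (inv1z M q b)).
have -> : iter (q.+1 + d) mul1z (inv1z M q b) (- l%:Z - 1) =
          if l == 0%N then c * symb v else 0.
  rewrite addnC iterD -Bc//; apply: (@eq_mul1z_ge _ _ _ _ _ (- l%:Z - 1)) => // n nl.
  by rewrite (iter_mul1z_inv1z _ bK)// /M; lia.
(* the contribution of the annihilation mode A_i *)
have tail (i : nat) : iter (q.+1 + d) mul1z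
      (fun n => symb (B (n - i%:Z - 1) (A i%:Z v))) (- l%:Z - 1) =
    if (i == q) && (l == 0%N) then (-1) ^+ q *: (c * symb (heis N 0 v)) else 0.
  have [iq|qi] := ltnP i q.
    rewrite (ltn_eqF iq) andFb iter_mul1zE big1// => j _.
    by rewrite /A fdivderiv_nneg (bin_small iq) mulr0 scale0r tB.1 raddf0 scaler0.
  have Av0 : A i%:Z v \in charges nonneg by apply/keeps_divderiv/v0/keeps_heis.
  have -> : iter (q.+1 + d) mul1z (fun n => symb (B (n - i%:Z - 1) (A i%:Z v)))
      (- l%:Z - 1) = iter q.+1 mul1z (iter d mul1z (fun n => symb (B n (A i%:Z v))))
      (- l%:Z - 1 + (- i%:Z - 1)).
    rewrite -iterD -[RHS]iter_mul1z_shift; apply: eq_mul1z => n.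
    by congr (symb (B _ _)); lia.
  rewrite iter_mul1zE big_ord_recr /= binn scale1r big1 ?add0r => [|j _].
    have -> : - l%:Z - 1 + (- i%:Z - 1) + q.+1%:Z = - (l + (i - q))%N%:Z - 1 by lia.
    rewrite Bc//.
    have -> : (l + (i - q) == 0)%N = (i == q) && (l == 0%N) by lia.
    case: eqP => // iE; case: eqP => // _ /=.
    by rewrite /A iE fdivderiv_nneg binn mulr1 subrr linearZ_LR /= scalerAr.
  have jq := ltn_ord j.
  have -> : - l%:Z - 1 + (- i%:Z - 1) + j%:Z = - (l + (i - j).+1)%N%:Z - 1 by lia.
  by rewrite Bc// ifF ?scaler0//; lia.
rewrite iter_mul1z_sum (eq_bigr _ (fun (i : 'I_T) _ => tail i)).
have qT : (q < T)%N by rewrite /T; lia.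
rewrite (bigD1 (Ordinal qT))//= eqxx big1 ?addr0 => [|i iq]; last first.
  by rewrite -[(i : nat) == q]/(i == Ordinal qT) (negPf iq).
rewrite /rmulX; case: eqP => _ /=; last by rewrite mul0r scaler0 addr0.
by rewrite -scalerDr -scalerAl -[c * xyX * symb v]mulrA xyX_symb mulrDr mulrA.
Qed.
End NormallyOrdered.

Section SymbolIsMultiplicative.
Variables (F : fieldType) (N : nat).
Hypothesis char0 : forall n, n%:R == 0 :> F = (n == 0%N).
Local Notation VL := {malg F[idx]}.
Local Notation VB := (VB F).
Local Notation xyalg := (xyalg F N).
Local Notation mul1z := (@mul1z F xyalg).
Local Notation symb := (@symb F N).
Implicit Types (k : idx) (v w : VL) (a b : VB).

HB.instance Definition _ := GRing.Linear.copy (@vbval F) (\val : VB -> VL).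

(** The vertex operator of a basis vector, for an explicit list of modes so that
    one can induct on it. *)
Definition Yfold (s : seq nat) (p : int) : vfield F :=
  foldr (fun i B => nop (fdivderiv i (heis N)) B) (Yexp N p) s.

Lemma Yfold_truncated s p : lower_truncated (Yfold s p).
Proof.
elim: s => [|i s IH]; first exact: Yexp_truncated.
exact: nop_truncated (divderiv_heis_truncated N char0 i) IH.
Qed.

Hypothesis N_gt0 : (0 < N)%N.

Lemma has_symbol_Yfold s p : 0 <= p ->
  has_symbol (Yfold s p) (\sum_(i <- s) i.+1 + N * absz p ^ 2)
    ((\prod_(i <- s) (-1) ^+ i) *: (symb_top F N p * xyX F N ^+ size s)).
Proof.
move=> p0; elim: s => [|i s IH].
  by rewrite !big_nil add0n scale1r mulr1; apply: has_symbol_Yexp.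
rewrite !big_cons -addnA exprSr mulrA -scalerA [_ *: (_ * _ * _)]scalerAl.
by apply: has_symbol_nop => //; apply: Yfold_truncated.
Qed.

Lemma bpart_id (B : pred idx) v : bpart B (bpart B v) = bpart B v.
Proof.
apply: (@eq_on_bas _ _ (fun w => bpart B (bpart B w))) => [c x y|c x y|k _].
- by rewrite !linearP.
- by rewrite linearP.
- by rewrite bpart_bas; case: ifP => Bk; rewrite ?bpart_bas ?Bk ?raddf0.
Qed.

(** The index l = 0 gives the Zhu product and l = 1 the circle product. *)
Lemma symb_zhu_res (l d : nat) a b : homog (wpartB N) d a ->
  symb (vbval (zhu_res (@YB F N) l.+1 d a b)) =
  if l == 0%N then symb (vbval a) * symb (vbval b) else 0.
Proof.
rewrite /homog /wpartB => /(congr1 (@vbval _)) /= aE.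
pose wt k := weight N k == d.
pose v := vbval b; have v0 : v \in charges nonneg := vbvalP b.
pose g w := \sum_(j < d.+1) 'C(d, j)%:R *: symb (YL N w (j%:Z - l.+1%:Z) v).
pose h w := if l == 0%N then symb w * symb v else 0.
have -> : symb (vbval (zhu_res (@YB F N) l.+1 d a b)) = g (vbval a).
  rewrite /zhu_res 2!raddf_sum; apply: eq_bigr => j _ /=.
  by rewrite !linearZ_LR.
have gL : linear g.
  move=> c x y; rewrite /g scaler_sumr -big_split /=; apply: eq_bigr => j _.
  by rewrite /YL !linearP.
have hL : linear h.
  move=> c x y; rewrite /h; case: ifP => _; last by rewrite scaler0 addr0.
  by rewrite linearP mulrDl scalerAl.
rewrite -[RHS]/(h (vbval a)) -aE.
apply: (@eq_on_bas _ _ (fun w => g (bpart wt w)) (fun w => h (bpart wt w))).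
- by move=> c x y; rewrite linearP gL.
- by move=> c x y; rewrite linearP hL.
move=> k ka; rewrite bpart_bas; case: ifP => [/eqP kd|_]; last first.
  have := gL (-1) 0 0; have := hL (-1) 0 0.
  by rewrite !scaleN1r oppr0 addr0 !addNr => -> ->.
have k0 : 0 <= k.2 by have /allP := vbvalP a; apply.
have := has_symbol_Yfold k.1 k0 v0 l.
rewrite -/(weight N k) kd -symb_bas /h => <-.
rewrite iter_mul1zE; apply: eq_bigr => j _.
rewrite /YL linext_bas; congr (_ *: symb (Ybas N k _ v)); lia.
Qed.

Lemma symb_zhu_circ d a b : homog (wpartB N) d a ->
  symb (vbval (zhu_circ (@YB F N) d a b)) = 0.
Proof. exact: symb_zhu_res. Qed.

Lemma sum_wpartB a :
  a = \sum_(d <- undup [seq weight N k | k <- enum_fset (msupp (vbval a))]) wpartB N d a.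
Proof.
apply: val_inj; rewrite raddf_sum /=.
transitivity (\sum_(k <- msupp (vbval a)) (vbval a)@_k *: bas F k); first exact: malg_basE.
rewrite /bpart /linext exchange_big big_seq [RHS]big_seq; apply: eq_bigr => k ka.
rewrite -scaler_sumr (bigD1_seq (weight N k)) ?undup_uniq//=; last first.
  by rewrite mem_undup map_f.
by rewrite eqxx big1 ?addr0// => d; rewrite eq_sym => /negPf ->.
Qed.

Lemma wpartB_homog d a : homog (wpartB N) d (wpartB N d a).
Proof. by apply: val_inj; rewrite /= bpart_id. Qed.

Lemma symb_zhu_star a b :
  symb (vbval (zhu_star (@YB F N) (wpartB N) a b)) = symb (vbval a) * symb (vbval b).
Proof.
rewrite {2}(sum_wpartB a); set r := undup _.
have -> : zhu_star (@YB F N) (wpartB N) a b =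
          \sum_(d <- r) zhu_res (@YB F N) 1 d (wpartB N d a) b.
  rewrite /zhu_star (fsbigE r) ?undup_uniq//=.
    by apply: eq_bigl => d; rewrite in_setT.
  move=> d _ dr; have -> : wpartB N d a = 0.
    apply: val_inj; rewrite /= /bpart /linext big_seq big1// => k ka.
    case: eqP => [kd|_]; last by rewrite scaler0.
    by case/negP: dr; rewrite mem_undup -kd map_f.
  rewrite /zhu_res big1// => j _; apply/val_inj; rewrite /= /YL raddf0.
  by rewrite scaler0.
rewrite !raddf_sum mulr_suml; apply: eq_bigr => d _ /=.
by rewrite (symb_zhu_res 0 b (wpartB_homog d a)).
Qed.
End SymbolIsMultiplicative.

(** * Vertex operators on the vacuum and on highest weight vectors *)
Section VacuumAndTops.
Variables (F : fieldType) (N : nat).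
Local Notation VL := {malg F[idx]}.
Implicit Types (k : idx) (v w : VL) (A B : vfield F).

Lemma expneg0 m w : expneg N m 0 w = w.
Proof. by rewrite /expneg /oexp big_ord1 /= invr1 scale1r. Qed.

Lemma expneg1 m w : expneg N m 1 w = m%:~R *: heis N (-1) w.
Proof.
rewrite /expneg /oexp big_ord_recl big_ord1 /= scaler0 add0r big_nat1 subnn /=.
by rewrite /bump leqnn addn0 (_ : 1`! = 1)%N // invr1 mulr1 scale1r.
Qed.

(** The annihilation exponential is trivial on highest weight vectors, so
    Y(e^(m alpha),z) e^(q alpha) is z^(2Nmq) times the creation exponential.  The
    scalar c lets the formula be used after an operator that rescales the vector,
    the modes of Y(e^(m alpha),z) not being bundled as linear maps. *)
Lemma Yexp_top m q n (c : F) : Yexp N m n (c *: bas F (mset0, q)) =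
  if n + (2 * N)%:Z * m * q + 1 <= 0
  then expneg N m (absz (n + (2 * N)%:Z * m * q + 1)) (c *: bas F (mset0, m + q)) else 0.
Proof.
set e := (2 * N)%:Z * m * q; set u := c *: bas F (mset0, m + q).
have killed y : exppos N m y u = if y == 0%N then u else 0.
  apply: oexp_kill => [j|[//|j] _]; first by rewrite raddf0 scaler0.
  by rewrite linearZ_LR /= heis_basE mset0E muln0 scale0r !scaler0.
have termE (t : nat * nat * int) :
    expneg N m t.1.1 (exppos N m t.1.2 (eshift m (zpow N m t.2 (c *: bas F (mset0, q))))) =
    if (t.1.2 == 0%N) && (t.2 == e) then expneg N m t.1.1 u else 0.
  rewrite linearZ_LR /= zpow_bas -/e [e == _]eq_sym; case: (t.2 == e).
    rewrite linearZ_LR /= eshift_bas killed andbT.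
    by case: (t.1.2 == 0%N); [exact: erefl | exact: expneg_0].
  by rewrite andbF scaler0 raddf0 exppos_0 expneg_0.
have -> : Yexp N m n (c *: bas F (mset0, q)) = \sum_(t \in [set t : nat * nat * int |
    t.1.1%:Z - t.1.2%:Z + t.2 = - n - 1])
    if (t.1.2 == 0%N) && (t.2 == e) then expneg N m t.1.1 u else 0.
  by apply: eq_fsbigr => t _; apply: termE.
(* What remains concerns the index set only; hiding the exponential keeps
   conversion from unfolding it. *)
move: (expneg N m) {termE killed} => h.
case: ifP => [n0|n0]; last first.
  rewrite fsbig1// => -[[x y] l] /= E; case: eqP => //= y0; case: eqP => //= le.
  by exfalso; move: n0 E; rewrite y0 le; lia.
rewrite (fsbigE [:: (absz (n + e + 1), 0%N, e)])//; first last.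
- move=> -[[x y] l] /= E; rewrite inE => tne; case: ifP => // /andP[/eqP y0 /eqP le].
  case/negP: tne; apply/eqP; congr (_, _, _) => //; move: E n0; rewrite y0 le; lia.
- by move=> t; rewrite /= inE => /eqP -> /=; lia.
rewrite big_cons big_nil /= eqxx addr0 ifT//.
by rewrite in_setE /=; lia.
Qed.

Local Notation vac := (bas F (mset0, 0)).

(** On the vacuum only the creation modes of A survive, and the first n of them
    suffice for m >= -n, since the nonnegative modes of B vanish there. *)
Lemma nop_vac A B (n : nat) (m : int) : lower_truncated A -> lower_truncated B ->
  (forall i : nat, A i%:Z vac = 0) -> (forall i : nat, B i%:Z vac = 0) ->
  - n%:Z <= m -> nop A B m vac = \sum_(r < n) A (Negz r) (B (m + r%:Z) vac).
Proof.
move=> [A0 _] [B0 _] Av Bv nm; rewrite /nop [X in _ + X]fsbig1 ?addr0; last first.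
  by move=> [i|//] _; rewrite Av B0.
rewrite (@fsum_neg _ _ n) => [|r nr].
  by apply: eq_bigr => r _; congr (A _ (B _ _)); lia.
have -> : m - Negz r - 1 = (absz (m + r%:Z))%:Z by lia.
by rewrite Bv A0.
Qed.

Lemma heis_vac (i : nat) : heis N i%:Z vac = 0.
Proof.
rewrite heis_basE; case: i => [|i]; first by rewrite mulr0 scale0r.
by rewrite /= mset0E muln0 scale0r.
Qed.

Hypothesis char0 : forall n, n%:R == 0 :> F = (n == 0%N).

Lemma divderiv_heis_vac q (i : nat) : fdivderiv q (heis N) i%:Z vac = 0.
Proof.
rewrite fdivderiv_nneg//; have [iq|qi] := ltnP i q.
  by rewrite bin_small// mulr0 scale0r.
have -> : i%:Z - q%:Z = (i - q)%N%:Z by lia.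
by rewrite heis_vac scaler0.
Qed.

(** The elements (i), stated outside V_B so that no subtype gets in the way. *)
Definition shift_sums : set VL := [set x | exists (n : nat) u,
  u \in charges nonneg /\ x = heis N (Negz n.+1) u + heis N (Negz n) u].

Lemma heis_createC (i j : nat) v :
  heis N (Negz i) (heis N (Negz j) v) = heis N (Negz j) (heis N (Negz i) v).
Proof.
apply/eqP; rewrite -subr_eq0 heis_relP.
have -> : (Negz i + Negz j == 0) = false by lia.
by rewrite scale0r.
Qed.

Lemma heis_shift_sums (i : nat) w :
  w \in lspan_pred shift_sums -> heis N (Negz i) w \in lspan_pred shift_sums.
Proof.
move/lspanP => [n [c [x [xS ->]]]]; rewrite raddf_sum; apply: rpred_sum => j _ /=.
rewrite linearZ_LR /=; apply: rpredZ; have [m [u [u0 ->]]] := xS j.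
apply: lspan_gen; exists m, (heis N (Negz i) u); split; first exact: keeps_heis.
rewrite raddfD.
exact: (congr2 +%R (heis_createC i m.+1 u) (heis_createC i m u)).
Qed.

(** The basis vectors as iterated creation operators, on which one can induct. *)
Definition monomial (s : seq nat) (p : int) : VL :=
  foldr (fun i => heis N (Negz i)) (bas F (mset0, p)) s.

Lemma monomial_charges (P : pred int) s p : P p -> monomial s p \in charges P.
Proof.
by move=> Pp; elim: s => [|i s IH]; [exact: charges_bas | exact: keeps_heis].
Qed.

Lemma heis_create (i : nat) k :
  heis N (Negz i) (bas F k) = bas F ((i +` k.1)%mset, k.2).
Proof. exact: heis_basE. Qed.

Lemma monomial_bas (s : {mset nat}) p : monomial s p = bas F (s, p).
Proof.
rewrite -[s in RHS]seq_mset_id; elim: (s : seq nat) => [|i t IH].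
  congr (bas F (_, p)); apply/msetP=> x; by rewrite mset_seqE mset0E.
apply: etrans (congr1 (heis N (Negz i)) IH) _.
apply: etrans (heis_create i (seq_mset t, p)) _ => /=.
by congr (bas F (_, p)); rewrite -mset_cons.
Qed.

(** Y(a,z)1 = exp(z L(-1)) a to first order.  By induction on the monomial,
    L(-1)a = a_(-2) 1 is congruent to p alpha(-1)a - deg(a) a modulo the elements
    (i): commuting L(-1) past alpha(-i-1) costs (i+1) alpha(-i-2), congruent to
    -(i+1) alpha(-i-1). *)
Lemma Yfold_vac (s : seq nat) (p : int) : 0 <= p ->
  [/\ forall i : nat, Yfold N s p i%:Z vac = 0,
      Yfold N s p (-1) vac = monomial s p &
      Yfold N s p (-2) vac + (\sum_(i <- s) i.+1)%:R *: monomial s p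
        - p%:~R *: heis N (-1) (monomial s p) \in lspan_pred shift_sums].
Proof.
move=> p0; elim: s => [|i s [IH0 IH1 IH2]].
  have YE n := Yexp_top p 0 n 1; rewrite !scale1r mulr0 addr0 in YE.
  split=> [n||].
  - by rewrite /= YE ifF//; lia.
  - by rewrite /= YE /= expneg0.
  - by rewrite /= YE /= expneg1 big_nil scale0r addr0 subrr rpred0.
have tB := Yfold_truncated N char0 s p.
have tA := divderiv_heis_truncated N char0 i.
have nopE m n : - n%:Z <= m -> Yfold N (i :: s) p m vac =
    \sum_(r < n) fdivderiv i (heis N) (Negz r) (Yfold N s p (m + r%:Z) vac).
  by apply: nop_vac => //; apply: divderiv_heis_vac.
set x := monomial s p in IH1 IH2 *.
rewrite -[monomial (i :: s) p]/(heis N (Negz i) x); split=> [n||].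
- by rewrite (nopE _ 0%N) ?big_ord0//; lia.
- by rewrite (nopE _ 1%N)// big_ord1 addr0 IH1 fdivderiv_neg// add0n binn scale1r.
rewrite (nopE (-2) 2%N isT).
rewrite big_ord_recl big_ord1.
rewrite addr0.
rewrite -[Yfold N s p (-2 + _) vac]/(Yfold N s p (-1) vac) IH1.
rewrite !(fdivderiv_neg char0).
rewrite add0n binn scale1r -[(lift _ _ + i)%N]/(i.+1) binSn big_cons.
have -> : heis N (-1) (heis N (Negz i) x) = heis N (Negz i) (heis N (-1) x).
  exact: heis_createC.
have IH2' := heis_shift_sums i IH2.
rewrite raddfB raddfD /= !linearZ_LR /= scalerN in IH2'.
have xi : heis N (Negz i.+1) x + heis N (Negz i) x \in lspan_pred shift_sums.
  by apply: lspan_gen; exists i, x; rewrite monomial_charges.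
have regroup (a b c e : VL) (r d : nat) : a + r%:R *: b + (r + d)%:R *: c - e =
    a + d%:R *: c - e + r%:R *: (b + c).
  rewrite natrD scalerDl scalerDr -!addrA; congr (_ + _).
  by rewrite [RHS]addrA [RHS]addrC -!addrA.
by rewrite regroup; apply: rpredD => //; apply: rpredZ.
Qed.
End VacuumAndTops.

(** * Elements of O(V_B) *)
Section ElementsOfO.
Variables (F : fieldType) (N : nat).
Hypothesis char0 : forall n, n%:R == 0 :> F = (n == 0%N).
Local Notation VL := {malg F[idx]}.
Local Notation VB := (VB F).
Implicit Types (k : idx) (v w : VL) (a b u : VB).

Local Notation circs := (zhu_circs (@YB F N) (wpartB N)).
Local Notation O := (lspan_pred circs).

Lemma heisB_is_linear n : linear (@heisB F N n).
Proof. by move=> c x y; apply: val_inj; apply: linearP. Qed.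
HB.instance Definition _ n :=
  GRing.isLinear.Build F VB VB *:%R (@heisB F N n) (heisB_is_linear n).

(** Basis vectors as elements of V_B; the default value 0 is taken exactly on the
    basis vectors of negative charge. *)
Definition basB k : VB := insubd 0 (bas F k).

Lemma val_basB k : 0 <= k.2 -> vbval (basB k) = bas F k.
Proof. by move=> k0; apply: (@insubdK _ _ VB); apply: (@charges_bas F nonneg). Qed.

Lemma basBE a : a = \sum_(k <- msupp (vbval a)) (vbval a)@_k *: basB k.
Proof.
apply: val_inj; rewrite raddf_sum /=.
apply: (etrans (malg_basE (vbval a))); rewrite big_seq [RHS]big_seq.
apply: eq_bigr => k ka; rewrite val_basB//.
by have /allP := vbvalP a; apply.
Qed.

(** To put f(u) into a span it is enough to treat basis vectors; this is needed
    because the circle product is available only for homogeneous vectors. *)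
Lemma basB_ind (S : set VB) (P : pred int) (f : {linear VB -> VB}) u :
  (forall k, 0 <= k.2 -> P k.2 -> f (basB k) \in lspan_pred S) ->
  chargesB P u -> f u \in lspan_pred S.
Proof.
move=> fS /allP Pu; rewrite [u]basBE raddf_sum big_seq; apply: rpred_sum => k ku /=.
rewrite linearZ_LR /= rpredZ// fS//; last exact: Pu.
by have /allP := vbvalP u; apply.
Qed.

Lemma basB_homog k : homog (wpartB N) (weight N k) (basB k).
Proof.
apply: val_inj; rewrite /=.
have [k0|k0] := boolP (0 <= k.2).
  by rewrite val_basB// bpart_bas eqxx.
have -> : basB k = 0; last exact: raddf0.
rewrite /basB /insubd insubF//; apply: contraNF k0 => /allP; apply.
by rewrite msuppU oner_eq0 inE.
Qed.

Lemma circ_in_O k l : zhu_circ (@YB F N) (weight N k) (basB k) (basB l) \in O.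
Proof.
apply: lspan_gen; exists (weight N k), (weight N l), (basB k), (basB l).
by split=> //; apply: basB_homog.
Qed.

Lemma val_circ d k u : 0 <= k.2 -> vbval (zhu_circ (@YB F N) d (basB k) u) =
  \sum_(j < d.+1) 'C(d, j)%:R *: Yfold N k.1 k.2 (j%:Z - 2) (vbval u).
Proof.
move=> k0; rewrite /zhu_circ /zhu_res raddf_sum; apply: eq_bigr => j _.
rewrite /= val_basB//; congr (_ *: _).
exact: linext_bas.
Qed.

(** Normally ordered product with the identity field Y(1,z). *)
Lemma nop_Yexp0 (A : vfield F) n v : (forall i, A i 0 = 0) ->
  nop A (Yexp N 0) n v = A n v.
Proof.
move=> A0; rewrite /nop.
have -> : \sum_(i \in [set i : int | i < 0]) A i (Yexp N 0 (n - i - 1) v) =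
    \sum_(i \in [set i : int | i < 0]) if i == n then A n v else 0.
  apply: eq_fsbigr => i _; rewrite Yexp0E.
  have -> : (n - i - 1 == -1) = (i == n) by lia.
  by case: eqP => [->|_]; rewrite ?A0.
have -> : \sum_(i \in [set i : int | 0 <= i]) Yexp N 0 (n - i - 1) (A i v) =
    \sum_(i \in [set i : int | 0 <= i]) if i == n then A n v else 0.
  apply: eq_fsbigr => i _; rewrite Yexp0E.
  have -> : (n - i - 1 == -1) = (i == n) by lia.
  by case: eqP => [->|_].
rewrite !fsum_delta; have [n0|n0] := ltP n 0.
  rewrite ifT ?in_setE// ifF ?addr0//; apply/negP; rewrite in_setE /=; lia.
rewrite ifF ?add0r ?ifT ?in_setE//; apply/negP; rewrite in_setE /=; lia.
Qed.

(** (alpha(-n-1)1) o u is (n+1) times this element: in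
    Res (1+z)^(n+1) z^(-2) d^n alpha(z)/n!, the terms z^j with 0 <= j < n produced
    by (1+z)^(n+1) z^(-2) are killed by the n-th derivative, leaving only z^(-2)
    and (n+1) z^(-1). *)
Lemma shift_in_O (n : nat) u :
  heisB N (- n%:Z - 2) u + heisB N (- n%:Z - 1) u \in O.
Proof.
pose f u := heisB N (- n%:Z - 2) u + heisB N (- n%:Z - 1) u.
have fL : linear f by move=> c x y; rewrite /f !linearP scalerDr addrACA.
have [g gE] := linear_bundle fL.
rewrite -[X in X \in _]/(f u) gE; apply: (@basB_ind _ predT); last exact/allP.
move=> l l0 _; rewrite -gE.
pose k : idx := ([mset n]%mset, 0).
have wk : weight N k = n.+1.
  by rewrite /weight /= enum_msetn big_seq1 muln0 addn0.
suff E : zhu_circ (@YB F N) (weight N k) (basB k) (basB l) = n.+1%:R *: f (basB l).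
  have := circ_in_O k l; rewrite E => /(rpredZ n.+1%:R^-1).
  by rewrite scalerA mulVf ?scale1r// char0.
apply: val_inj; rewrite -[LHS]/(vbval _) (@val_circ _ k _ (lexx _)) wk /= val_basB//.
rewrite enum_msetn /=.
have YE m : nop (fdivderiv n (heis N)) (Yexp N 0) m (bas F l) =
            fdivderiv n (heis N) m (bas F l).
  apply: nop_Yexp0; exact: (divderiv_heis_truncated N char0 n).1.
rewrite big_ord_recl big_ord_recl big1 => [|j _].
  rewrite !YE bin0 bin1 scale1r addr0 scalerDr.
  rewrite (fdivderiv_neg char0 n _ 1) (fdivderiv_neg char0 n _ 0) add0n binn.
  rewrite scale1r binSn.
  have -> : - n%:Z - 2 = Negz n.+1 by lia.
  by have -> : - n%:Z - 1 = Negz n by lia.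
rewrite YE; have -> : (bump 0 (bump 0 j))%:Z - 2 = (j : nat)%:Z by rewrite /bump; lia.
by rewrite fdivderiv_nneg// (bin_small (ltn_ord j)) mulr0 scale0r scaler0.
Qed.
End ElementsOfO.

Section MoreElementsOfO.
Variables (F : fieldType) (N : nat).
Hypothesis char0 : forall n, n%:R == 0 :> F = (n == 0%N).
Local Notation VL := {malg F[idx]}.
Local Notation VB := (VB F).
Implicit Types (k : idx) (v w : VL) (a b u : VB).
Local Notation circs := (zhu_circs (@YB F N) (wpartB N)).
Local Notation O := (lspan_pred circs).

Lemma basB_create (i : nat) (s : {mset nat}) (p : int) : 0 <= p ->
  heisB N (Negz i) (basB F (s, p)) = basB F ((i +` s)%mset, p).
Proof.
move=> p0; apply: val_inj; rewrite -[RHS]/(vbval _) val_basB//=.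
by rewrite val_basB// heis_create.
Qed.

Lemma lift_shift_sums w : w \in lspan_pred (@shift_sums F N) ->
  exists2 x : VB, x \in O & vbval x = w.
Proof.
move=> /lspanP[n [c [x [xS ->]]]].
have xO i : exists y : VB, y \in O /\ vbval y = x i.
  have [m [u [u0 ->]]] := xS i.
  exists (heisB N (- m%:Z - 2) (InVB u0) + heisB N (- m%:Z - 1) (InVB u0)).
  split; first exact: shift_in_O.
  have -> : - m%:Z - 2 = Negz m.+1 by lia.
  by have -> : - m%:Z - 1 = Negz m by lia.
have [y yP] := choice xO; exists (\sum_i c i *: y i).
  by apply: rpred_sum => i _; apply/rpredZ/(yP i).1.
by rewrite raddf_sum; apply: eq_bigr => i _; rewrite /= (yP i).2.
Qed.

(** a o 1 = (L(-1) + L(0)) a, which modulo (i) is p (alpha(-1) + Np) a in charge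
    p. *)
Lemma derivation_in_O k : (0 < N)%N -> 1 <= k.2 ->
  heisB N (-1) (basB F k) + (N * absz k.2)%:R *: basB F k \in O.
Proof.
move=> N0 k1; have k0 : 0 <= k.2 by lia.
pose vac : idx := (mset0, 0); pose p := absz k.2.
have [V0 V1 V2] := Yfold_vac N char0 k.1 k0.
set z := _ + _ in V2; have [x xO xz] := lift_shift_sums V2.
have kE : monomial F N k.1 k.2 = bas F k by rewrite monomial_bas; case: (k).
pose d := \sum_(i <- (k.1 : seq nat)) i.+1.
have wE : weight N k = (d + N * p ^ 2)%N by [].
suff E : zhu_circ (@YB F N) (weight N k) (basB F k) (basB F vac) =
         x + p%:R *: (heisB N (-1) (basB F k) + (N * p)%:R *: basB F k).
  have := rpredB (circ_in_O F N k vac) xO.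
  rewrite E addrC addKr => /(rpredZ p%:R^-1); rewrite scalerA mulVf ?scale1r//.
  by rewrite char0 /p; lia.
apply: val_inj; rewrite -[LHS]/(vbval _) -[RHS]/(vbval _) val_circ//.
rewrite raddfD /= xz /z !val_basB// kE.
have w1 : (0 < weight N k)%N by rewrite wE addn_gt0 muln_gt0 N0 expn_gt0 /p; lia.
have -> : \sum_(j < (weight N k).+1) 'C(weight N k, j)%:R *:
    Yfold N k.1 k.2 (j%:Z - 2) (bas F vac) =
    Yfold N k.1 k.2 (-2) (bas F vac) + (weight N k)%:R *: bas F k.
  rewrite -(prednK w1) big_ord_recl big_ord_recl big1 => [|j _].
    by rewrite bin0 bin1 scale1r addr0 -kE -V1.
  have -> : (lift ord0 (lift ord0 j))%:Z - 2 = (j : nat)%:Z.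
    by rewrite /= /bump; lia.
  by rewrite V0 scaler0.
rewrite wE natrD scalerDl scalerDr scalerA.
have -> : k.2%:~R = p%:R :> F by rewrite /p -[in LHS](gez0_abs k0).
rewrite -natrM mulnCA mulnn [in RHS]addrA subrK addrA.
by [].
Qed.

(** In alpha(-q-1)e^alpha o e^((p-1) alpha), the factor z^(2N(p-1)) of
    Y(e^alpha,z) e^((p-1) alpha) cancels all poles except those coming from
    alpha(0), which contributes (-1)^q 2N(p-1) z^(-q-1); with q = 2N(p-1) - 2 that
    pole is simple after division by z^2 and its residue is a multiple of
    e^(p alpha). *)
Lemma top_in_O (p : int) : (0 < N)%N -> 2 <= p -> basB F (mset0, p) \in O.
Proof.
move=> N0 p2; pose n := absz (p - 1); pose q := (2 * N * n - 2)%N.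
pose k : idx := ([mset q]%mset, 1); pose l : idx := (mset0, n%:Z).
have n1 : (1 <= n)%N by rewrite /n; lia.
have Nn : (1 <= N * n)%N by rewrite muln_gt0 N0.
have qE : (q.+2 = 2 * (N * n))%N by rewrite /q -mulnA; lia.
pose c : F := (-1) ^+ q * (2 * (N * n))%:R.
have c0 : c != 0.
  by rewrite mulf_neq0 ?signr_eq0 ?char0//; lia.
suff E : zhu_circ (@YB F N) (weight N k) (basB F k) (basB F l) = c *: basB F (mset0, p).
  have := rpredZ c^-1 (circ_in_O F N k l).
  by rewrite E scalerA mulVf ?scale1r.
apply: val_inj; rewrite -[LHS]/(vbval _) -[RHS]/(vbval _) val_circ//.
rewrite linearZ_LR /= !val_basB ?enum_msetn//=; last by lia.
pose u := c *: bas F (mset0, p).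
have YE (m : int) : - 2 <= m ->
    nop (fdivderiv q (heis N)) (Yexp N 1) m (bas F l) = if m == -2 then u else 0.
  move=> m2; rewrite /nop fsbig1 ?add0r; last first.
    move=> i /= i0; have := Yexp_top N 1 n (m - i - 1) (1 : F); rewrite !scale1r => ->.
    rewrite ifF; first exact: (divderiv_heis_truncated N char0 q).1.
    by apply/negbTE; rewrite -ltNge; lia.
  have kill (r : nat) : r != q ->
      Yexp N 1 (m - r%:Z - 1) (fdivderiv q (heis N) r%:Z (bas F l)) = 0.
    move=> rq; rewrite fdivderiv_nneg//.
    have -> : ((-1) ^+ q * 'C(r, q)%:R) *: heis N (r%:Z - q%:Z) (bas F l) = 0.
      have [rq'|qr] := ltnP r q; first by rewrite bin_small// mulr0 scale0r.
      have -> : r%:Z - q%:Z = (r - q).-1.+1%:Z by lia.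
      by rewrite heis_basE mset0E muln0 scale0r scaler0.
    exact: (Yexp_truncated F N 1).1.
  rewrite (@fsum_nneg _ _ q.+1) => [|r qr]; last by apply: kill; lia.
  rewrite big_ord_recr big1 ?add0r => [|r _]; last first.
    by apply: kill; rewrite neq_ltn /= ltn_ord.
  rewrite /= fdivderiv_nneg// binn mulr1 subrr heis_basE scalerA.
  have -> : (-1) ^+ q * ((2 * N)%:R * l.2%:~R) = c.
    by rewrite /c /= -natrM -mulnA.
  rewrite Yexp_top.
  have -> : m - q%:Z - 1 + (2 * N)%:Z * 1 * n%:Z + 1 = m + 2.
    by rewrite mulr1 -PoszM -mulnA -qE; lia.
  rewrite add0r; case: lerP => m_le; last by rewrite ifF//; lia.
  have -> : m = - 2%:Z by lia.
  rewrite eqxx.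
  rewrite expneg0 /u; congr (_ *: bas F (_, _)).
  by rewrite /n; lia.
rewrite big_ord_recl YE// bin0 scale1r big1 ?addr0// => j _.
by rewrite YE ?ifF ?scaler0//= /bump; lia.
Qed.

(** Relation (i) read as a rule for replacing alpha(-i-2) by -alpha(-i-1). *)
Lemma shift_descent (T : {pred VB}) (p : int) : submod_closed T -> 0 <= p ->
  (forall (n : nat) u, heisB N (- n%:Z - 2) u + heisB N (- n%:Z - 1) u \in T) ->
  forall (i : nat) t, basB F ((i +` t)%mset, p) \in T -> basB F ((i.+1 +` t)%mset, p) \in T.
Proof.
move=> [_ Tsub] p0 shT i t it; have := shT i (basB F (t, p)).
have -> : - i%:Z - 2 = Negz i.+1 by lia.
have -> : - i%:Z - 1 = Negz i by lia.
have E := congr2 +%R (basB_create i.+1 t p0) (basB_create i t p0).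
by rewrite E => /(Tsub (-1) _ _ it); rewrite scaleN1r addrCA addNr addr0.
Qed.

End MoreElementsOfO.

(** * The Zhu algebra of V_B *)
Section StructureOfZhuAlgebra.
Variables (F : fieldType) (N : nat).
Hypothesis char0 : forall n, n%:R == 0 :> F = (n == 0%N).
Hypothesis N_gt0 : (0 < N)%N.
Local Notation VL := {malg F[idx]}.
Local Notation VB := (VB F).
Local Notation xyalg := (xyalg F N).
Implicit Types (k : idx) (a b u v : VB) (p : {poly F}).
Local Notation circs := (zhu_circs (@YB F N) (wpartB N)).
Local Notation O := (lspan_pred circs).
Local Notation symb := (@symb F N).
Local Notation zclass := (zhu_class (@YB F N) (wpartB N)).

Definition relations : set VB :=
  [set x | exists (n : nat) (u : VB),
     x = heisB N (- n%:Z - 2) u + heisB N (- n%:Z - 1) u]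
  `|` [set x | exists2 v : VB, chargesB (fun m : int => 1 <= m) v &
         x = heisB N (- 1) v + N%:R *: v]
  `|` [set x | exists2 k : int, 2 <= k & chargesB (fun m : int => m == k) x].
Local Notation J := (lspan_pred relations).

Lemma symb_O u : u \in O -> symb (vbval u) = 0.
Proof.
move=> /lspanP[n [c [x [xS ->]]]]; rewrite !raddf_sum big1// => i _ /=.
rewrite !linearZ_LR /=; have [d [e [a [b [ad _ ->]]]]] := xS i.
by rewrite symb_zhu_circ ?scaler0.
Qed.

(** Starting from e^(p alpha), [derivation_in_O] adds factors alpha(-1), and the
    relations (i) then raise the modes. *)
Lemma charge2_in_O k : 2 <= k.2 -> basB F k \in O.
Proof.
case: k => s p /= p2; have p0 : 0 <= p by lia.
have base n : basB F (msetn n 0%N, p) \in O.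
  elim: n => [|n IH]; first by rewrite msetn0; apply: top_in_O.
  have -> : msetn n.+1 0%N = (0%N +` msetn n 0%N)%mset.
    by apply/msetP => -[|x]; rewrite mset1DE !msetnE ?add1n.
  rewrite -(basB_create F N _ _ p0) -(rpredDr _ (rpredZ (N * absz p)%:R IH)).
  by apply: (@derivation_in_O _ _ char0 (_, p)) => //=; lia.
move: s; apply: mset_descent => [n|]; first exact: base.
apply: shift_descent; [exact: lspan_submod | exact: p0 | move=> n u; exact: shift_in_O].
Qed.

Lemma relations_in_O u : u \in J -> u \in O.
Proof.
apply: lspan_min => x [[[n [v ->]]|[v v1 ->]]|[k k2 xk]].
- exact: shift_in_O.
- pose f v := heisB N (- 1) v + N%:R *: v.
  have fL : linear f.
    by move=> c y z; rewrite /f linearP !scalerDr !scalerA mulrC addrACA.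
  have [g gE] := linear_bundle fL.
  rewrite -[X in X \in _]/(f v) gE; apply: basB_ind v1 => -[s p] /= p0 p1.
  rewrite -gE /f; have [p1'|p1'] := eqVneq p 1.
    have := @derivation_in_O _ _ char0 (s, p) N_gt0 p1.
    by rewrite /= p1' muln1.
  have p2 : 2 <= p by lia.
  by rewrite rpredD ?rpredZ ?charge2_in_O// ?(basB_create F N _ _ p0) charge2_in_O.
- have := @basB_ind F circs (fun m : int => m == k) idfun x.
  by apply=> // l _ /eqP lk; apply: charge2_in_O; rewrite lk.
Qed.

Definition sect_poly p : VB := \sum_(i < size p) p`_i *: basB F (msetn i 0%N, 0).

Lemma sect_poly_widen n p : (size p <= n)%N ->
  sect_poly p = \sum_(i < n) p`_i *: basB F (msetn i 0%N, 0).
Proof.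
move=> pn; rewrite /sect_poly (big_ord_widen _ (fun i => p`_i *: basB F (msetn i 0%N, 0)) pn).
rewrite big_mkcond; apply: eq_bigr => i _; case: ltnP => // pi.
by rewrite nth_default// scale0r.
Qed.

(** A linear section of the symbol map: x^i comes from alpha(-1)^i 1 and y from
    e^alpha. *)
Definition sect (x : xyalg) : VB :=
  sect_poly (xyp x) + xyc x *: basB F (mset0, 1).

Lemma sect_is_linear : linear sect.
Proof.
move=> c x y; rewrite /sect /=.
pose n := maxn (size (c *: xyp x + xyp y)) (maxn (size (xyp x)) (size (xyp y))).
rewrite (@sect_poly_widen n (xyp x)) ?(@sect_poly_widen n (xyp y)); first last.
- by rewrite /n !leq_max leqnn !orbT.
- by rewrite /n !leq_max leqnn !orbT.
rewrite (@sect_poly_widen n) ?leq_maxl// scalerDr scalerA scaler_sumr addrACA.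
rewrite -scalerDl; congr (_ + _); rewrite -big_split; apply: eq_bigr => i _ /=.
by rewrite coefD coefZ scalerDl scalerA.
Qed.
HB.instance Definition _ :=
  GRing.isLinear.Build F xyalg VB *:%R sect sect_is_linear.

Lemma symb_basB k : 0 <= k.2 -> symb (vbval (basB F k)) =
  (\prod_(i <- (k.1 : seq nat)) (-1) ^+ i) *: (symb_top F N k.2 * xyX F N ^+ size k.1).
Proof. by move=> k0; rewrite val_basB// symb_bas. Qed.

Lemma symb_power n : symb (vbval (basB F (msetn n 0%N, 0))) = xyX F N ^+ n.
Proof.
rewrite symb_basB//= enum_msetn big_nseq size_nseq mul1r.
by rewrite (_ : iter _ _ _ = 1) ?scale1r//; elim: n => //= n ->; rewrite mulr1.
Qed.

Lemma symb_e1 : symb (vbval (basB F (mset0, 1))) = xyY F N.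
Proof. by rewrite symb_basB//= enum_mset0 big_nil scale1r mulr1. Qed.

Lemma sectK : cancel sect (fun u => symb (vbval u)).
Proof.
case=> p c; rewrite /sect /= raddfD /= linearZ_LR /= symb_e1 xyE; congr (_ + _).
rewrite !raddf_sum -[p in RHS]coefK poly_def raddf_sum; apply: eq_bigr => i _ /=.
rewrite !linearZ_LR /= symb_power. 
by rewrite rmorphXn /= horner_algX mulr_algl.
Qed.

(** Vectors congruent modulo J to the section of their symbol. *)
Definition reducible : {pred VB} := fun u => u - sect (symb (vbval u)) \in J.

Lemma reducibleE u : (u \in reducible) = (u - sect (symb (vbval u)) \in J).
Proof. by rewrite unfold_in. Qed.

Lemma reducible_submod : submod_closed reducible.
Proof.
split=> [|c u v]; rewrite !reducibleE.
  by rewrite !raddf0 addr0 rpred0.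
move=> uJ vJ.
have symbL : symb (vbval (c *: u + v)) = c *: symb (vbval u) + symb (vbval v).
  by rewrite !linearP.
rewrite symbL sect_is_linear opprD addrACA -scalerBr.
by apply: rpredD => //; apply: rpredZ.
Qed.
HB.instance Definition _ :=
  GRing.isSubmodClosed.Build F VB reducible reducible_submod.

Lemma relation_reducible u : u \in J -> u \in reducible.
Proof.
move=> uJ; rewrite reducibleE.
by rewrite (symb_O (relations_in_O uJ)) raddf0 subr0.
Qed.

Lemma basB_reducible k : 0 <= k.2 -> basB F k \in reducible.
Proof.
case: k => s p /= p0.
have [p2|p2] := lerP 2 p.
  apply/relation_reducible/lspan_gen; right; exists p => //.
  by rewrite /chargesB /= val_basB//; apply: (@charges_bas F (pred1 p)); apply: eqxx.
have shiftT (i : nat) u : heisB N (- i%:Z - 2) u + heisB N (- i%:Z - 1) u \in reducible.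
  by apply/relation_reducible/lspan_gen; left; left; exists i, u.
move: s; apply: mset_descent => [n|]; last first.
  by apply: shift_descent shiftT; [exact: reducible_submod | exact: p0].
have [->|p1] := eqVneq p 0.
  rewrite reducibleE symb_power.
  suff -> : sect (xyX F N ^+ n) = basB F (msetn n 0%N, 0) by rewrite subrr rpred0.
  have -> : xyX F N ^+ n = MkXY N 'X^n 0.
    by rewrite xyE scale0r addr0 rmorphXn /= horner_algX.
  rewrite /sect /= scale0r addr0 /sect_poly size_polyXn big_ord_recr /= coefXn eqxx.
  rewrite scale1r big1 ?add0r// => i _.
  by rewrite coefXn ltn_eqF ?scale0r.
have -> : p = 1%:Z by lia.
elim: n => [|n IH].
  rewrite msetn0 reducibleE symb_e1.
  have -> : sect (xyY F N) = basB F (mset0, 1).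
    by rewrite /sect /sect_poly /= size_poly0 big_ord0 add0r scale1r.
  by rewrite subrr rpred0.
have -> : msetn n.+1 0%N = (0%N +` msetn n 0%N)%mset.
  by apply/msetP => -[|x]; rewrite mset1DE !msetnE ?add1n.
rewrite -(@basB_create F N 0 _ 1 isT) -(rpredDr _ (rpredZ N%:R IH)).
apply/relation_reducible/lspan_gen; left; right; exists (basB F (msetn n 0%N, 1)) => //.
by rewrite /chargesB /= val_basB//; apply: (@charges_bas F (fun m : int => 1 <= m)).
Qed.

Lemma all_reducible u : u - sect (symb (vbval u)) \in J.
Proof.
rewrite -reducibleE [u]basBE big_seq; apply: rpred_sum => k ku.
apply/rpredZ/basB_reducible; have /allP := vbvalP u; exact.
Qed.

Lemma ker_symb u : symb (vbval u) = 0 -> u \in J.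
Proof. by move=> u0; have := all_reducible u; rewrite u0 raddf0 subr0. Qed.

(** Since O(V_B) = ker symb, symbols separate classes. *)
Lemma zclassP u v : zclass u = zclass v <-> symb (vbval u) = symb (vbval v).
Proof.
split=> [/eqP/lclassP/lspanP/symb_O /eqP|E].
  by rewrite !raddfB subr_eq0 => /eqP.
apply/eqP/lclassP/lspanP/relations_in_O/ker_symb.
by rewrite !raddfB /= E subrr.
Qed.

Lemma zhuOE : zhuO (@YB F N) (wpartB N) = lspan relations.
Proof.
apply/seteqP; split=> u /lspanP uS; apply/lspanP.
  exact/ker_symb/symb_O.
exact: relations_in_O.
Qed.

Lemma zclass_star a b : zclass (zhu_star (@YB F N) (wpartB N) a b) =
  zhu_mul (zclass a) (zclass b).
Proof.
have reprE u : symb (vbval (repr (zclass u))) = symb (vbval u).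
  by apply/zclassP; apply: lclass_repr.
by apply/zclassP; rewrite !symb_zhu_star// !reprE.
Qed.

Lemma zhuA_isomorphic : alg_isomorphic (@zhu_mul F VB (@YB F N) (wpartB N))
  (zhu_one (@YB F N) (wpartB N) (vacB F)) xyalg.
Proof.
pose f (X : zhuA (@YB F N) (wpartB N)) : xyalg := symb (vbval (repr X)).
have fE u : f (zclass u) = symb (vbval u).
  by apply/zclassP; apply: lclass_repr.
have rE X : zclass (repr X) = X by apply: lclass_repr.
have fL : linear f.
  move=> c X Y; rewrite -[X]rE -[Y]rE.
  rewrite /zhu_class -[c *: _]lclassZ -raddfD -/zclass !fE.
  by rewrite linearP.
have [g gE] := linear_bundle fL.
exists g; split.
- exists (fun x => zclass (sect x)) => [X|x]; rewrite -gE.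
    by rewrite -[RHS]rE; apply/zclassP; rewrite sectK.
  by rewrite fE sectK.
- rewrite -gE fE /= symb_bas /= enum_mset0 big_nil.
  by rewrite scale1r mulr1.
- by move=> X Y; rewrite -!gE -{1}[X]rE -{1}[Y]rE -zclass_star fE symb_zhu_star// /f.
Qed.
End StructureOfZhuAlgebra.

Theorem theoremB (R : realType) (N : nat) (hN : (1 <= N)%N) :
  let C : fieldType := complex R in
  let V_B := VB C in
  [/\ zhuO (@YB C N) (wpartB N) =
        lspan
          ([set x | exists (n : nat) (u : V_B),
              x = heisB N (- n%:Z - 2) u + heisB N (- n%:Z - 1) u]
           `|` [set x | exists2 v : V_B, chargesB (fun m : int => 1 <= m) v &
                  x = heisB N (- 1) v + N%:R *: v]
           `|` [set x | exists2 k : int, 2 <= k & chargesB (fun m : int => m == k) x]),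
      forall a b : V_B,
        zhu_class (@YB C N) (wpartB N) (zhu_star (@YB C N) (wpartB N) a b) =
        zhu_mul (zhu_class (@YB C N) (wpartB N) a) (zhu_class (@YB C N) (wpartB N) b)
    & alg_isomorphic (@zhu_mul C V_B (@YB C N) (wpartB N))
        (zhu_one (@YB C N) (wpartB N) (vacB C)) (xyalg C N)].
Proof.
move=> C V_B; have char0 n : n%:R == 0 :> C = (n == 0%N) by exact: pnatr_eq0.
split.
- exact: zhuOE char0 hN.
- exact: zclass_star char0 hN.
- exact: zhuA_isomorphic char0 hN.
Qed.
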